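(* Let $\Delta \in \mathbb{N}$ and let $\nu, \tau, \eta$ be positive constants with $\nu \leq \tau \ll \eta < 1$. Then there exist constants $\beta > 0$ and $n_0 \in \mathbb{N}$ such that the following holds. Let $H$ be a bipartite graph on $n \geq n_0$ vertices with $\Delta(H) \leq \Delta$ and bandwidth at most $\beta n$. Let $G$ be a graph on $n$ vertices with minimum degree $\delta(G) \geq \eta n$ which is a robust $(\nu,\tau)$-expander. Then $G$ contains a copy of $H$.
   Context: The notation $\nu \leq \tau \ll \eta < 1$ means: $\eta\in(0,1)$ is given, $\tau$ is chosen sufficiently small with respect to $\eta$ (there is an increasing function $f$ such that the statement holds whenever $\tau \leq f(\eta)$), and $0<\nu \leq \tau$. For $0 < \nu \leq \tau < 1$, a graph $G$ on $n$ vertices and $S \subseteq V(G)$, the $\nu$-robust neighbourhood $RN_{\nu,G}(S)$ is the set of vertices $v \in V(G)$ with $|N(v) \cap S| \geq \nu n$. $G$ is a robust $(\nu,\tau)$-expander if every $S \subseteq V(G)$ with $\tau n \leq |S| \leq (1-\tau) n$ satisfies $|RN_{\nu,G}(S)| \geq |S| + \nu n$. A graph $H$ on $n$ vertices has bandwidth at most $b$ if there is a labelling of its vertices by $1,\dots,n$ such that $|i-j| \leq b$ for every edge $ij$. *)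

(* Defs.v *)
From mathcomp Require Import all_boot.
From Stdlib Require Import Reals.
Set Implicit Arguments. Unset Strict Implicit. Unset Printing Implicit Defensive.

Definition simple_graph (n : nat) (E : rel 'I_n) : Prop :=
  symmetric E /\ irreflexive E.

Definition nbhd (n : nat) (E : rel 'I_n) (v : 'I_n) : {set 'I_n} :=
  [set u | E v u].

Definition robust_nbhd (n : nat) (nu : R) (E : rel 'I_n) (S : {set 'I_n})
  : {set 'I_n} :=
  [set v | if Rle_dec (nu * INR n) (INR #|nbhd E v :&: S|) then true else false].

Definition robust_expander (n : nat) (nu tau : R) (E : rel 'I_n) : Prop :=
  forall S : {set 'I_n},
    (tau * INR n <= INR #|S|)%R -> (INR #|S| <= (1 - tau) * INR n)%R ->
    (INR #|S| + nu * INR n <= INR #|robust_nbhd nu E S|)%R.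

Definition max_degree_le (n : nat) (E : rel 'I_n) (D : nat) : Prop :=
  forall v, #|nbhd E v| <= D.

Definition min_degree_ge (n : nat) (E : rel 'I_n) (d : R) : Prop :=
  forall v, (d <= INR #|nbhd E v|)%R.

Definition bipartite (n : nat) (E : rel 'I_n) : Prop :=
  exists c : 'I_n -> bool, forall u v, E u v -> c u != c v.

Definition bandwidth_le (n : nat) (E : rel 'I_n) (b : R) : Prop :=
  exists lab : 'I_n -> 'I_n, injective lab /\
    forall u v, E u v -> (Rabs (INR (lab u) - INR (lab v)) <= b)%R.

Definition contains_copy (n m : nat) (G : rel 'I_n) (H : rel 'I_m) : Prop :=
  exists f : 'I_m -> 'I_n, injective f /\ forall u v, H u v -> G (f u) (f v).

(* Main.v *)
(** Let [X], [Y] be the colour classes of [H], with [|Y| >= n/2]. A suitable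
    injection [phi] of [X] into [G] is fixed first; then [Y] is matched to the
    remaining vertices of [G], where [y] may go to [w] when [phi (N y)] lies in
    [N w]. Neither the regularity lemma nor the blow-up lemma is needed.

    All but few vertices of [G] are split into boundedly many clusters [V_i],
    each with a set [U_i] that contains almost all neighbours of every vertex of
    [V_i] and towards which [V_i] is one-sidedly regular: every large subset of
    [U_i] is densely seen by almost all of [V_i]. Such a pair is found greedily.
    The vertices of [H] are cut into short blocks in bandwidth order, every
    block is assigned to a cluster, and [X] and [Y] are both spread over the
    clusters in proportion to their sizes; consecutive blocks are linked by
    paths of clusters whose sets [U_i] overlap, which exist by robust expansion.
    Then [phi] sends each [x] into its own cluster, one vertex at a time,
    derandomized by a potential with two parts: one guarantees that every [w]
    can host linearly many [y], the other ranges over all sets [T] of vertices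
    and guarantees that few [y] assigned to a cluster [i] with [T :&: U_i] large
    have no admissible image in [T]. With these properties the robust expansion
    of [G] yields Hall's condition. *)
Require Import Defs.
From Stdlib Require Import Reals.
From mathcomp Require Import all_boot all_order all_algebra.
From mathcomp Require Import ring lra zify.
From mathcomp Require Import Rstruct.
Set Implicit Arguments. Unset Strict Implicit. Unset Printing Implicit Defensive.
Import Order.TTheory GRing.Theory Num.Theory.
Local Open Scope ring_scope.

(** * Hall's theorem and derandomized colouring *)

(** What must survive the placement of [X] is Hall's condition for exponentially many sets [T] of
    leftover vertices, and this shapes the proof. If [T] meets [Uc i] in few vertices for all [i] in
    some family, the union [S] of these clusters sends few edges to [T]. Hence [T] nearly avoids the
    robust neighbourhood of [S], which exceeds [S] by [nu * n], while the other clusters supply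
    neighbours of [T]; the margin [nu * n] pays for all errors. The comparison requires the images
    of [X] to be spread evenly over boundedly many sets, so almost all of them are confined to a
    reservoir [VX] that is balanced on these sets in advance. Expansion says nothing when [S] is
    empty or almost everything. For the second, special vertices [Ys] with disjoint neighbourhoods
    let each [w] host linearly many [y]. *)

Definition nb (T : finType) (E : rel T) (v : T) : {set T} := [set u | E v u].

(** Induction on [#|S|]. If some proper nonempty [A] is tight, [A] and its complement in [S] are
    matched separately; otherwise every such set has a spare neighbour, so one element may take any
    of its neighbours. *)
Lemma hall (T : finType) (E : rel T) (S : {set T}) :
  (forall A : {set T}, A \subset S -> (#|A| <= #|\bigcup_(a in A) nb E a|)%N) ->
  exists f : T -> T, {in S &, injective f} /\ {in S, forall a, E a (f a)}.
Proof.
have [k] := ubnP #|S|; elim: k E S => // k IHk E S leSk hallS.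
have [->|[s sS]] := set_0Vmem S.
  by exists id; split=> [x y|x]; rewrite inE.
case: (boolP [exists A : {set T}, [&& A \proper S, A != set0 &
    #|\bigcup_(a in A) nb E a| <= #|A|]%N]).
- case/existsP=> A /and3P[prA A0 tightA].
  have sAS : A \subset S := proper_sub prA.
  have ltAS : (#|A| < #|S|)%N := proper_card prA.
  have [||f1 [inj1 E1]] := IHk E A; first by apply: leq_trans ltAS _.
    by move=> C sCA; apply: hallS; apply: subset_trans sAS.
  pose NA := \bigcup_(a in A) nb E a.
  pose E' : rel T := fun a b => E a b && (b \notin NA).
  have [||f2 [inj2 E2]] := IHk E' (S :\: A).
  + rewrite cardsD (setIidPr sAS); rewrite -card_gt0 in A0.
    by move: leSk ltAS A0; lia.
  + move=> C sC.
    have sCS : C \subset S by apply: subset_trans sC (subsetDl _ _).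
    have dCA : [disjoint C & A].
      by rewrite disjoints_subset; apply: subset_trans sC _; rewrite setDE subsetIr.
    (* Since [A] is tight, a deficiency of [C] outside [NA] would be a deficiency of [C :|: A]. *)
    have := hallS (C :|: A); rewrite subUset sCS sAS => /(_ isT).
    rewrite cardsU (disjoint_setI0 dCA) cards0 subn0.
    have sub : \bigcup_(a in C :|: A) nb E a \subset (\bigcup_(a in C) nb E' a) :|: NA.
      apply/subsetP => b /bigcupP[a]; rewrite inE => aCA; rewrite inE => Eab.
      rewrite inE; case: (boolP (b \in NA)) => [_|bNA]; first by rewrite orbT.
      rewrite orbF; case/orP: aCA => aC.
        by apply/bigcupP; exists a; rewrite // inE /E' Eab.
      by case/negP: bNA; apply/bigcupP; exists a; rewrite // inE.
    have := leq_trans (subset_leq_card sub) (leq_card_setU _ _).1.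
    by move: tightA; rewrite -/NA; lia.
  have f2NA a : a \in S :\: A -> f2 a \notin NA by case/E2/andP.
  have f1NA a : a \in A -> f1 a \in NA.
    by move=> aA; apply/bigcupP; exists a; rewrite // inE E1.
  exists (fun a => if a \in A then f1 a else f2 a); split=> [a b aS bS|a aS] /=.
  + case: ifP => aA; case: ifP => bA; first exact: inj1.
    * by move=> e; have := f2NA b; rewrite !inE bA bS -e f1NA // => /(_ isT).
    * by move=> e; have := f2NA a; rewrite !inE aA aS e f1NA // => /(_ isT).
    * by apply: inj2; rewrite !inE ?aA ?bA.
  + case: ifP => aA; first exact: E1.
    by have /andP[] : E' a (f2 a) by apply: E2; rewrite !inE aA.
- rewrite negb_exists => /forallP slack.
  have [b Esb] : exists b, b \in nb E s.
    apply/set0Pn; rewrite -card_gt0.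
    by have := hallS [set s]; rewrite sub1set sS cards1 big_set1; apply.
  pose E' : rel T := fun a b' => E a b' && (b' != b).
  have [||f [injf Ef]] := IHk E' (S :\ s).
  + by move: leSk; rewrite (cardsD1 s S) sS; lia.
  + move=> C sC; have [->|C0] := eqVneq C set0; first by rewrite cards0.
    have prC : C \proper S by apply: sub_proper_trans sC _; rewrite properD1.
    have := slack C; rewrite prC C0 /= -ltnNge => ltC.
    rewrite -ltnS; apply: (leq_trans ltC).
    have sub : \bigcup_(a in C) nb E a \subset b |: \bigcup_(a in C) nb E' a.
      apply/subsetP => c /bigcupP[a aC]; rewrite inE => Eac; rewrite !inE.
      case: eqVneq => //= cb; apply/bigcupP; exists a => //.
      by rewrite inE /E' Eac.
    apply: leq_trans (subset_leq_card sub) _.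
    by rewrite cardsU1; case: (_ \notin _); rewrite ?addnS ?add0n // leqW.
  exists (fun a => if a == s then b else f a); split=> [a c aS cS|a aS] /=.
  + case: eqVneq => [->|as_]; case: eqVneq => [->|cs] //.
    * by have := Ef c; rewrite !inE cs cS => /(_ isT)/andP[_ /eqP n] e; case: n.
    * by have := Ef a; rewrite !inE as_ aS => /(_ isT)/andP[_ /eqP n] e; case: n.
    * by apply: injf; rewrite !inE ?as_ ?cs.
  + case: eqVneq => [->|as_]; first by rewrite inE in Esb.
    by have /andP[] : E' a (f a) by apply: Ef; rewrite !inE as_.
Qed.

Lemma exists_le_sum (R : realFieldType) (T : finType) (wt F : T -> R) (K : R) :
  (forall c, 0 <= wt c) -> \sum_c wt c = 1 -> \sum_c wt c * F c <= K ->
  exists c, F c <= K.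
Proof.
move=> wt0 wt1 le; apply/existsP; apply: contraT; rewrite negb_exists => /forallP h.
have : \sum_c wt c * K < \sum_c wt c * F c.
  rewrite lt_neqAle; apply/andP; split; last first.
    by apply: ler_sum => c _; rewrite ler_wpM2l // ltW // ltNge h.
  apply/negP => /eqP e.
  have : \sum_c wt c * (F c - K) = 0.
    by under eq_bigr do rewrite mulrBr; rewrite sumrB e subrr.
  have F0 c : true -> 0 <= wt c * (F c - K).
    by move=> _; rewrite mulr_ge0 // subr_ge0 ltW // ltNge h.
  move/(psumr_eq0P F0) => z.
  have w0 c : wt c = 0.
    have /eqP := z c isT; rewrite mulf_eq0 subr_eq0 => /orP[/eqP //|/eqP e2].
    by have := h c; rewrite e2 lexx.
  by move: wt1; rewrite big1 // => /eqP; rewrite eq_sym oner_eq0.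
by rewrite -mulr_suml wt1 mul1r => /lt_le_trans/(_ le); rewrite ltxx.
Qed.

Lemma exists_le_avg (R : realFieldType) (T : finType) (A : {set T}) (F : T -> R) (K : R) :
  (0 < #|A|)%N -> \sum_(v in A) F v <= #|A|%:R * K -> exists2 v, v \in A & F v <= K.
Proof.
move=> A0 le; apply/exists_inP; apply: contraT; rewrite negb_exists_in => /forall_inP h.
have [v0 v0A] : exists v, v \in A by apply/set0Pn; rewrite -card_gt0.
have : \sum_(v in A) K < \sum_(v in A) F v.
  rewrite (bigD1 v0) //= [ltRHS](bigD1 v0) //= ltr_leD //; first by rewrite ltNge h.
  by apply: ler_sum => v /andP[vA _]; rewrite ltW // ltNge h.
by rewrite sumr_const -mulr_natl => /lt_le_trans/(_ le); rewrite ltxx.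
Qed.

(* If every item independently picks class [c] with probability [wt c], the
   expected squared discrepancy is at most [2 * sum a^2]; choosing the classes
   one at a time without increasing the conditional expectation derandomizes
   this. *)
Lemma balanced_coloring (R : realFieldType) (T J C : finType) (a : T -> J -> R) (wt : C -> R) :
  (forall c, 0 <= wt c) -> \sum_c wt c = 1 ->
  exists ch : T -> C,
    \sum_j \sum_c (\sum_(t | ch t == c) a t j - wt c * \sum_t a t j) ^+ 2
      <= 2 * \sum_t \sum_j a t j ^+ 2.
Proof.
move=> wt0 wt1.
pose D (ch : T -> C) (r : seq T) j c :=
  \sum_(t <- r) a t j * ((ch t == c)%:R - wt c).
suff H (r : seq T) : uniq r -> exists ch : T -> C,
    \sum_j \sum_c D ch r j c ^+ 2 <= 2 * \sum_(t <- r) \sum_j a t j ^+ 2.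
  have [ch le] := H _ (index_enum_uniq T); exists ch; apply: le_trans le.
  apply: ler_sum => j _; apply: ler_sum => c _.
  rewrite le_eqVlt; apply/orP; left; apply/eqP; congr (_ ^+ 2); rewrite /D.
  under [RHS]eq_bigr do rewrite mulrBr mulrC.
  rewrite sumrB -mulr_suml mulrC big_mkcond /=; congr (_ - _).
  by apply: eq_bigr => t _; case: eqP; rewrite ?mul1r ?mul0r.
elim: r => [_|t r IHr /= /andP[tr ur]].
  have [c _] := exists_le_sum (F := fun _ => 0) (K := 0) wt0 wt1
    (ltac:(by rewrite big1 // => c _; rewrite mulr0)).
  exists (fun _ => c); rewrite !big_nil mulr0 big1 // => j _; rewrite big1 // => d _.
  by rewrite /D big_nil expr0n.
have [ch le] := IHr ur.
pose A := \sum_j a t j ^+ 2.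
pose Q e := \sum_j \sum_c (D ch r j c + a t j * ((e == c)%:R - wt c)) ^+ 2.
have [e leQ] : exists e, Q e <= \sum_j \sum_c D ch r j c ^+ 2 + 2 * A.
  apply: (exists_le_sum wt0 wt1).
  (* For a class [e] drawn with weights [wt] the linear term of the square has mean zero, so the
     increase is only the variance, at most [2 * A]. *)
  have cross c : \sum_e wt e * ((e == c)%:R - wt c) = 0.
    under eq_bigr do rewrite mulrBr.
    rewrite sumrB -mulr_suml wt1 mul1r (bigD1 c) //= eqxx mulr1 big1 ?addr0 ?subrr //.
    by move=> d /negPf->; rewrite mulr0.
  have w1 c : wt c <= 1.
    by rewrite -wt1 (bigD1 c) //= lerDl sumr_ge0.
  have var e : \sum_c ((e == c)%:R - wt c) ^+ 2 <= 2.
    have : \sum_c ((e == c)%:R + wt c) <= 2.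
      rewrite big_split /= wt1 (bigD1 e) //= eqxx big1 ?addr0; first by rewrite /=; lra.
      by move=> d /negPf; rewrite eq_sym => ->.
    apply: le_trans; apply: ler_sum => c _.
    have : 0 <= wt c * (1 - wt c) by rewrite mulr_ge0 ?subr_ge0.
    by have := wt0 c; case: (e == c); rewrite /= ?mulr1n ?mulr0n; nra.
  have -> : \sum_e wt e * Q e =
      \sum_j \sum_c D ch r j c ^+ 2 +
      \sum_e wt e * \sum_j a t j ^+ 2 * \sum_c ((e == c)%:R - wt c) ^+ 2.
    transitivity (\sum_e (wt e * (\sum_j \sum_c D ch r j c ^+ 2) +
       wt e * (\sum_j a t j ^+ 2 * \sum_c ((e == c)%:R - wt c) ^+ 2) +
       \sum_j \sum_c 2 * D ch r j c * a t j * (wt e * ((e == c)%:R - wt c)))).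
      apply: eq_bigr => e _; rewrite /Q -!mulrDr.
      under [X in _ + X]eq_bigr => j _.
        under eq_bigr => c _.
          have -> : 2 * D ch r j c * a t j * (wt e * ((e == c)%:R - wt c)) =
            wt e * (2 * D ch r j c * a t j * ((e == c)%:R - wt c)) by ring.
          over.
        rewrite -mulr_sumr; over.
      rewrite -mulr_sumr -mulrDr; congr (_ * _).
      rewrite -!big_split /=; apply: eq_bigr => j _.
      rewrite mulr_sumr -!big_split /=; apply: eq_bigr => c _; ring.
    rewrite !big_split /= -mulr_suml wt1 mul1r.
    rewrite [X in _ + X = _]exchange_big /= [X in _ + X = _]big1 ?addr0 // => j _.
    rewrite exchange_big big1 //= => c _; by rewrite -mulr_sumr cross mulr0.
  rewrite lerD2l.
  apply: le_trans (_ : \sum_e wt e * (2 * A) <= _); last by rewrite -mulr_suml wt1 mul1r.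
  apply: ler_sum => e _; rewrite ler_wpM2l // /A mulr_sumr; apply: ler_sum => j _.
  by rewrite mulrC ler_wpM2r // sqr_ge0.
exists (fun u => if u == t then e else ch u).
rewrite big_cons mulrDr [leRHS]addrC; apply: le_trans (lerD le (lexx _)).
apply: le_trans leQ; rewrite le_eqVlt; apply/orP; left; apply/eqP.
apply: eq_bigr => j _; apply: eq_bigr => c _; congr (_ ^+ 2).
rewrite /D big_cons eqxx addrC; congr (_ + _).
rewrite !big_seq; apply: eq_bigr => u ur'.
have -> // : (u == t) = false.
by apply: contraNF tr => /eqP <-.
Qed.

(** * One-sided regular clusters *)

Definition thin (R : realFieldType) (V : finType) (E : rel V) (rho : R) (C A : {set V}) : {set V} :=
  [set x in A | #|nb E x :&: C|%:R < rho * #|C|%:R].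

Lemma card_diffI (T : finType) (A B C : {set T}) : (#|A :&: C| <= #|A :\: B| + #|B :&: C|)%N.
Proof.
apply: leq_trans (leq_card_setU _ _).1; apply: subset_leq_card.
by apply/subsetP => x; rewrite !inE => /andP[-> ->]; case: (x \in B).
Qed.

Lemma card_natr_le (R : numDomainType) (T : finType) (A B : {set T}) :
  A \subset B -> #|A|%:R <= #|B|%:R :> R.
Proof. by move=> sAB; rewrite ler_nat subset_leq_card. Qed.

Lemma card_bigcup_disjoint (I T : finType) (P : pred I) (F : I -> {set T}) :
  (forall i j, i != j -> [disjoint F i & F j]) ->
  #|\bigcup_(i | P i) F i| = (\sum_(i | P i) #|F i|)%N.
Proof.
move=> disj; pose F' i := if P i then F i else set0.
have -> : \bigcup_(i | P i) F i = \bigcup_i F' i.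
  by rewrite big_mkcond.
rewrite -sum1_card partition_disjoint_bigcup => [|i j ij].
  rewrite [RHS]big_mkcond; apply: eq_bigr => i _; rewrite /F'.
  by case: ifP => _; rewrite sum1_card ?cards0.
rewrite /F'; case: ifP => _; case: ifP => _; rewrite ?disjoints_subset ?sub0set ?setC0 ?subsetT //.
by rewrite -disjoints_subset disj.
Qed.

Lemma double_count (R : realFieldType) (V : finType) (E : rel V) (S T : {set V}) (a b : R) :
  symmetric E ->
  (forall x, x \in S -> #|nb E x :&: T|%:R <= a) ->
  (forall y, y \in T -> b <= #|nb E y :&: S|%:R) ->
  b * #|T|%:R <= a * #|S|%:R.
Proof.
move=> symE leS leT.
have cnt (A B : {set V}) : (\sum_(x in A) #|nb E x :&: B| = \sum_(x in A) \sum_(y in B) E x y)%N.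
  apply: eq_bigr => x _; rewrite -sum1_card big_mkcond [RHS]big_mkcond /=.
  by apply: eq_bigr => y _; rewrite !inE; case: (y \in B); rewrite ?andbF ?andbT //; case: (E x y).
have e : (\sum_(x in S) #|nb E x :&: T| = \sum_(y in T) #|nb E y :&: S|)%N.
  rewrite !cnt exchange_big /=; apply: eq_bigr => y _; apply: eq_bigr => x _.
  by rewrite symE.
rewrite mulrC mulr_natl -sumr_const; apply: (@le_trans _ _ (\sum_(y in T) #|nb E y :&: S|%:R)).
  exact: ler_sum.
rewrite -natr_sum -e natr_sum mulrC mulr_natl -sumr_const; exact: ler_sum.
Qed.

(* When some [C] witnesses failure, pass from [A] to its vertices that are thin
   towards [C] and delete [C] from [U]: at most [k] rounds, since [U] loses
   [eps1 * #|V|] vertices in each. *)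
Lemma extraction (R : realFieldType) (V : finType) (E : rel V) (eps eps1 rho : R) (k : nat)
    (A U : {set V}) :
  0 <= eps <= 1 -> 0 < eps1 -> (0 < #|V|)%N ->
  #|U|%:R <= k%:R * (eps1 * #|V|%:R) ->
  (forall x, x \in A -> #|nb E x :\: U|%:R <= rho * #|~: U|%:R) ->
  exists A' U' : {set V}, [/\ A' \subset A, eps ^+ k * #|A|%:R <= #|A'|%:R,
    forall x, x \in A' -> #|nb E x :\: U'|%:R <= rho * #|~: U'|%:R &
    forall C : {set V}, C \subset U' -> eps1 * #|V|%:R <= #|C|%:R ->
      #|thin E rho C A'|%:R <= eps * #|A'|%:R].
Proof.
move=> /andP[eps0 eps1'] e1 V0; have n0 : 0 < eps1 * #|V|%:R by rewrite mulr_gt0 // ltr0n.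
elim: k A U => [|k IHk] A U leU near.
  exists A, U; split=> // [|C sCU leC]; first by rewrite expr0 mul1r.
  have := card_natr_le R sCU; move: leU leC; rewrite mul0r; lra.
case: (boolP [forall C : {set V}, (C \subset U) && (eps1 * #|V|%:R <= #|C|%:R) ==>
      (#|thin E rho C A|%:R <= eps * #|A|%:R)]).
  move=> /forallP see; exists A, U; split=> //.
    by rewrite ler_piMl // exprn_ile1.
  by move=> C sC leC; have := see C; rewrite sC leC.
rewrite negb_forall => /existsP[C]; rewrite negb_imply -ltNge => /andP[/andP[sCU leC] ltC].
have cU : #|U|%:R = #|U :\: C|%:R + #|C|%:R :> R.
  by rewrite -natrD -(cardsID C U) (setIidPr sCU) addnC.
have cCU : #|~: (U :\: C)|%:R = #|~: U|%:R + #|C|%:R :> R.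
  rewrite -natrD; congr (_%:R); have := cardsC U; have := cardsC (U :\: C).
  by have := cardsID C U; rewrite (setIidPr sCU); lia.
have [||A' [U' [sA' leA' near' see']]] := IHk (thin E rho C A) (U :\: C).
- by move: leU; rewrite cU -natr1 mulrDl mul1r; lra.
(* The missed neighbours are charged to the complement of [U]: a thin vertex loses less than
   [rho * #|C|], which is exactly what the bound gains, so the error does not grow with the number
   of rounds. *)
- move=> x; rewrite inE => /andP[xA thx]; rewrite cCU mulrDr.
  apply: le_trans (lerD (near x xA) (ltW thx)); rewrite -natrD ler_nat.
  apply: leq_trans (leq_card_setU _ _).1; apply: subset_leq_card.
  by apply/subsetP => y; rewrite !inE => /andP[+ ->]; case: (y \in C); case: (y \in U).
exists A', U'; split=> //.
  by apply: subset_trans sA' _; apply/subsetP => x; rewrite inE => /andP[].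
apply: le_trans leA'; rewrite exprS mulrAC mulrC ler_wpM2l ?exprn_ge0 //.
exact: ltW.
Qed.

(** [rho] is both the density threshold and the bound on the share of neighbours outside [Uc i];
    [eps1] is the least relative size of a tested set and [eps] the share of exceptional vertices.
    Nothing is asked of the vertices of [Uc i]. *)
Definition cluster_system (R : realFieldType) (V : finType) (E : rel V) (rho eps eps1 gam : R)
    (m : nat) (Vc Uc : 'I_m -> {set V}) : Prop :=
  [/\ forall i j, i != j -> [disjoint Vc i & Vc j],
      forall i, gam * #|V|%:R <= #|Vc i|%:R,
      forall i x, x \in Vc i -> #|nb E x :\: Uc i|%:R <= rho * #|V|%:R &
      forall i (C : {set V}), C \subset Uc i -> eps1 * #|V|%:R <= #|C|%:R ->
        #|thin E rho C (Vc i)|%:R <= eps * #|Vc i|%:R].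

(** While more than [xi * #|V|] vertices remain, [extraction] with [U = setT] cuts another cluster
    out of them. The condition on [k * eps1] makes [k] rounds enough, and disjointness with
    [1 < M * gam] keeps the number of clusters below [M]. *)
Lemma exists_clusters (R : realFieldType) (V : finType) (E : rel V)
    (rho eps eps1 xi : R) (k M : nat) :
  0 <= rho -> 0 < eps <= 1 -> 0 < eps1 -> 0 < xi -> 1 <= k%:R * eps1 ->
  1 < M%:R * (eps ^+ k * xi) -> (0 < #|V|)%N ->
  exists m (Vc Uc : 'I_m -> {set V}), [/\ (m <= M)%N,
    cluster_system E rho eps eps1 (eps ^+ k * xi) Vc Uc &
    #|~: \bigcup_i Vc i|%:R <= xi * #|V|%:R].
Proof.
move=> rho0 /andP[eps0 epsle] e1 xi0 ke1 Mgt V0.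
have n0 : 0 < #|V|%:R :> R by rewrite ltr0n.
set gam := eps ^+ k * xi.
suff H j : (exists m (Vc Uc : 'I_m -> {set V}), [/\ (m <= j)%N,
    cluster_system E rho eps eps1 gam Vc Uc &
    #|~: \bigcup_i Vc i|%:R <= xi * #|V|%:R]) \/
    (exists Vc Uc : 'I_j -> {set V}, cluster_system E rho eps eps1 gam Vc Uc).
  case: (H M) => // -[Vc [Uc [disj big _ _]]]; exfalso.
  have : (\sum_i #|Vc i| <= #|V|)%N.
    by rewrite -(card_bigcup_disjoint xpredT disj) max_card.
  rewrite -(ler_nat R) natr_sum => le.
  have le2 : M%:R * gam * #|V|%:R <= #|V|%:R.
    rewrite -mulrA mulr_natl -{1}(card_ord M) -sumr_const.
    by apply: le_trans le; apply: ler_sum => i _; exact: big.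
  have : 1 * #|V|%:R < M%:R * gam * #|V|%:R by rewrite ltr_pM2r.
  by rewrite mul1r => /lt_le_trans/(_ le2); rewrite ltxx.
elim: j => [|j [[m [Vc [Uc [mj sys cov]]]]|[Vc [Uc sys]]]].
- by right; exists (fun _ => set0), (fun _ => set0); split=> -[].
- by left; exists m, Vc, Uc; split=> //; apply: leqW.
set Z := ~: \bigcup_i Vc i.
case: (leP #|Z|%:R (xi * #|V|%:R)) => [cov|big]; first by left; exists j, Vc, Uc.
right; have eps01 : 0 <= eps <= 1 by rewrite (ltW eps0).
have [||A [U [sA leA near see]]] := extraction (rho := rho) (k := k) (E := E) (A := Z) (U := setT) eps01 e1 V0.
- by rewrite cardsT mulrA ler_peMl // ltW.
- by move=> x _; rewrite setDT cards0 mulr_ge0.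
have [disj sz nr se] := sys.
have dA i : [disjoint Vc i & A].
  rewrite disjoint_sym disjoints_subset; apply: subset_trans sA _.
  by rewrite /Z setCS; apply: bigcup_sup.
pose ext (F : 'I_j -> {set V}) B (i : 'I_j.+1) := if unlift ord_max i is Some i' then F i' else B.
exists (ext Vc A), (ext Uc U); split.
- move=> i i'; rewrite /ext; case: unliftP => [u ->|->]; case: unliftP => [u' ->|->] //.
  + by move=> ne; apply: disj; apply: contra ne => /eqP->.
  + by rewrite disjoint_sym.
  + by rewrite eqxx.
- move=> i; rewrite /ext; case: unliftP => [u _|_] //.
  apply: le_trans leA; rewrite /gam -mulrA ler_wpM2l ?exprn_ge0 // ltW //; exact: ltW.
- move=> i x; rewrite /ext; case: unliftP => [u _|_]; first exact: nr.
  by move/near/le_trans; apply; rewrite ler_wpM2l // ler_nat max_card.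
- by move=> i C; rewrite /ext; case: unliftP => [u _|_]; [exact: se|exact: see].
Qed.

(** * Robust expansion connects the clusters *)

Definition rnb (R : realFieldType) (V : finType) (nu : R) (E : rel V) (S : {set V}) : {set V} :=
  [set v | nu * #|V|%:R <= #|nb E v :&: S|%:R].

Definition rexpander (R : realFieldType) (V : finType) (nu tau : R) (E : rel V) : Prop :=
  forall S : {set V}, tau * #|V|%:R <= #|S|%:R -> #|S|%:R <= (1 - tau) * #|V|%:R ->
    #|S|%:R + nu * #|V|%:R <= #|rnb nu E S|%:R.

Lemma card_setI_lower (R : realFieldType) (T : finType) (A B : {set T}) :
  #|A|%:R + #|B|%:R - #|T|%:R <= #|A :&: B|%:R :> R.
Proof.
have := cardsUI A B; have := max_card (mem (A :|: B)).
rewrite -(ler_nat R) => h /(congr1 (fun k => k%:R : R)); rewrite !natrD; lra.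
Qed.

Section Connectivity.
Variables (R : realFieldType) (V : finType) (E : rel V).
Variables (nu tau eta rho eps eps1 gam xi : R) (m : nat) (Vc Uc : 'I_m -> {set V}).
Hypotheses (symE : symmetric E) (sys : cluster_system E rho eps eps1 gam Vc Uc).
Hypotheses (nu0 : 0 < nu) (nutau : nu <= tau) (taueta : tau <= eta / 2) (eta1 : eta < 1).
Hypotheses (rho0 : 0 <= rho) (rhonu : rho <= nu ^+ 2 / 4) (xinu : xi <= nu / 2) (gam0 : 0 < gam).
Hypothesis cov : #|~: \bigcup_i Vc i|%:R <= xi * #|V|%:R.
Hypothesis mindeg : forall v, eta * #|V|%:R <= #|nb E v|%:R.
Hypothesis expE : rexpander nu tau E.
Hypothesis V0 : (0 < #|V|)%N.

Let n : R := #|V|%:R.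
Let n0 : 0 < n. Proof. by rewrite ltr0n. Qed.

Lemma cluster_nonempty i : exists x, x \in Vc i.
Proof.
apply/set0Pn; rewrite -card_gt0 -(ltr0n R); have [_ sz _ _] := sys.
by apply: lt_le_trans (sz i); rewrite mulr_gt0.
Qed.

Lemma cluster_target_large i : (eta - rho) * n <= #|Uc i|%:R.
Proof.
have [x xi'] := cluster_nonempty i; have [_ _ nr _] := sys.
have := nr _ _ xi'; have := mindeg x.
have : (#|nb E x| <= #|nb E x :\: Uc i| + #|Uc i|)%N.
  have := card_diffI (nb E x) (Uc i) setT; rewrite !setIT //.
rewrite -(ler_nat R) natrD -/n; lra.
Qed.

(** If [j] is unreachable from [i], let [VI] be the union of the reachable clusters and [P] its
    robust neighbourhood. The other clusters see little of [P], so the robust neighbourhood of [P]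
    lies in [VI] up to the uncovered vertices, although expanding twice adds [2 * nu * n]. If
    expansion does not apply because [VI] or [P] is too large, the minimum degree makes cluster [j]
    see much of [P]. *)
Lemma cluster_connected (i j : 'I_m) :
  connect (fun i j => nu ^+ 2 / 4 * n <= #|Uc i :&: Uc j|%:R) i j.
Proof.
set conn := (fun i j : 'I_m => _).
have [disj sz nr _] := sys.
move: (nu0) (nutau) (taueta) (eta1) (rho0) (rhonu) (xinu) (n0) => h1 h2 h3 h4 h5 h6 h7 h8.
have nu1 : nu < 1 / 2 by lra.
have nu2 : nu ^+ 2 <= nu / 2.
  by rewrite expr2 ler_pM2l //; lra.
have M a b : a <= b -> a * n <= b * n by move=> h; rewrite ler_wpM2r // ltW.
apply: contraT => nij; pose I := [pred l | connect conn i l].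
pose VI := \bigcup_(l | I l) Vc l.
have Iclosed l l' : I l -> conn l l' -> I l'.
  by move=> Il c; apply: connect_trans (connect1 c).
have outI x : x \notin VI -> x \in ~: (\bigcup_l Vc l) \/ exists2 l, ~~ I l & x \in Vc l.
  move=> xVI; case: (boolP (x \in \bigcup_l Vc l)) => [/bigcupP[l _ xl]|]; last by left; rewrite inE.
  right; exists l => //; apply: contra xVI => Il; by apply/bigcupP; exists l.
have boundI (S : {set V}) : (forall l x, ~~ I l -> x \in Vc l -> x \notin S) ->
    #|S|%:R <= #|VI|%:R + xi * n.
  move=> h; apply: le_trans (lerD (lexx _) cov); rewrite -natrD ler_nat.
  apply: leq_trans (leq_card_setU _ _).1; apply: subset_leq_card; apply/subsetP => x xS.
  rewrite in_setU; case: (boolP (x \in VI)) => //= /outI[//|[l Il xl]].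
  by have := h l x Il xl; rewrite xS.
have linked l x S : x \in Vc l -> nu * n <= #|nb E x :&: S|%:R -> (nu - rho) * n <= #|Uc l :&: S|%:R.
  move=> xl le; have := nr _ _ xl; have := card_diffI (nb E x) (Uc l) S.
  rewrite -(ler_nat R) natrD -/n; lra.
have Ii : I i by exact: connect0.
have large_i := cluster_target_large i.
(* A cluster with a vertex that robustly sees [Uc i] is linked to [i], so expansion of [Uc i] lands
   in [VI]. If [Uc i] is too large to expand, it meets [Uc j] substantially and [j] is linked to [i]
   directly. *)
have VIlarge : tau * n <= #|VI|%:R.
  case: (leP #|Uc i|%:R ((1 - tau) * n)) => [le|gt].
    have /expE : tau * #|V|%:R <= #|Uc i|%:R.
      by have := M tau (eta - rho) ltac:(lra); rewrite -/n; lra.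
    move=> /(_ le); rewrite -/n => ex.
    have : #|rnb nu E (Uc i)|%:R <= #|VI|%:R + xi * n.
      apply: boundI => l x Il xl; apply/negP; rewrite inE => /(linked _ _ _ xl) h.
      case/negP: Il; apply: (Iclosed i) => //; rewrite /conn setIC.
      by have := M (nu ^+ 2 / 4) (nu - rho) ltac:(lra); lra.
    by have := M (tau + xi) (eta - rho + nu) ltac:(lra); lra.
  case/negP: nij; apply: connect1; rewrite /conn.
  have := card_setI_lower R (Uc i) (Uc j); have := cluster_target_large j; rewrite -/n.
  by have := M (nu ^+ 2 / 4) (eta - rho - tau) ltac:(lra); lra.
pose P := rnb nu E VI.
(* Double counting between [VI] and [Uc l :&: P]: a vertex of [VI] has few neighbours there because
   its own target barely meets [Uc l], but a vertex of [P] has [nu * n] neighbours in [VI]. *)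
have sparse l : ~~ I l -> #|Uc l :&: P|%:R <= nu / 2 * n.
  move=> Il.
  have h : nu * n * #|Uc l :&: P|%:R <= (rho + nu ^+ 2 / 4) * n * #|VI|%:R.
    apply: (double_count symE) => [x /bigcupP[l' Il' xl']|y].
      have := nr _ _ xl'; have := card_diffI (nb E x) (Uc l') (Uc l :&: P).
      have : ~~ conn l' l by apply: contra Il => /(Iclosed _ _ Il').
      rewrite /conn -ltNge -(ler_nat R) natrD -/n.
      have : #|Uc l' :&: (Uc l :&: P)|%:R <= #|Uc l' :&: Uc l|%:R :> R.
        by apply: card_natr_le; rewrite setIA subsetIl.
      lra.
    by rewrite !inE => /andP[].
  have VIn : #|VI|%:R <= n by rewrite ler_nat max_card.
  have : nu * n * #|Uc l :&: P|%:R <= nu * n * (nu / 2 * n).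
    apply: le_trans h _.
    apply: (@le_trans _ _ ((nu ^+ 2 / 2) * n * n)); last by rewrite expr2; lra.
    have c0 : 0 <= rho + nu ^+ 2 / 4 by rewrite addr_ge0 // divr_ge0 ?sqr_ge0.
    apply: ler_pM => //; first by rewrite mulr_ge0 // ltW.
    by apply: M; lra.
  by rewrite ler_pM2l // mulr_gt0.
have fewP l x : ~~ I l -> x \in Vc l -> #|nb E x :&: P|%:R <= (rho + nu / 2) * n.
  move=> Il xl; have := nr _ _ xl; have := card_diffI (nb E x) (Uc l) P; have := sparse l Il.
  rewrite -(ler_nat R) natrD -/n; lra.
have [x xj] := cluster_nonempty j.
have few := fewP _ _ nij xj; have dx := mindeg x.
have big_contra : (1 - tau) * n < #|P|%:R -> False.
  move=> gt; have := card_setI_lower R (nb E x) P; rewrite -/n.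
  by have := M (rho + nu / 2) (eta - tau - nu / 10) ltac:(lra); have := M 0 nu ltac:(lra); have := mulr_gt0 nu0 n0; lra.
case: (leP #|VI|%:R ((1 - tau) * n)) => [le|gt].
  have ex := expE VIlarge le; rewrite -/n -/P in ex.
  case: (leP #|P|%:R ((1 - tau) * n)) => [leP|/big_contra //].
  have /expE/(_ leP) : tau * #|V|%:R <= #|P|%:R.
    by have := mulr_gt0 nu0 n0; rewrite -/n; lra.
  have := boundI (rnb nu E P); rewrite -/n.
  have hb : forall l x, ~~ I l -> x \in Vc l -> x \notin rnb nu E P.
    move=> l y Il yl; rewrite inE -ltNge; have := fewP _ _ Il yl; rewrite -/n.
    by have := M rho (nu / 8) ltac:(lra); have := mulr_gt0 nu0 n0; lra.
  by move=> /(_ hb); have := M xi _ xinu; have := mulr_gt0 nu0 n0; lra.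
exfalso; apply: big_contra; suff -> : P = setT by rewrite cardsT -/n; have := M _ _ nutau; have := mulr_gt0 nu0 n0; lra.
apply/setP => y; rewrite !inE; have := card_setI_lower R (nb E y) VI; have := mindeg y.
by rewrite -/n; have := M _ _ nutau; have := M _ _ taueta; lra.
Qed.

End Connectivity.

(** * Assigning the vertices of H to clusters *)

Lemma ler_norm_sqr (R : realFieldType) (x y : R) : 0 <= y -> x ^+ 2 <= y ^+ 2 -> `|x| <= y.
Proof.
move=> y0 le; rewrite -ler_sqr ?nnegrE //; first by rewrite real_normK ?num_real.
Qed.

(** The total squared discrepancy is at most [2 * #|J| * #|V|], hence so is each single square; for
    boundedly many sets a second moment therefore suffices. *)
Lemma balanced_sets (R : realFieldType) (V J C : finType) (F : J -> {set V}) (wt : C -> R) (e : R) :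
  (forall c, 0 <= wt c) -> \sum_c wt c = 1 -> 0 <= e ->
  2 * #|J|%:R <= e ^+ 2 * #|V|%:R ->
  exists ch : V -> C, forall j c,
    `| #|F j :&: [set v | ch v == c]|%:R - wt c * #|F j|%:R | <= e * #|V|%:R.
Proof.
move=> wt0 wt1 e0 le; pose a v j : R := (v \in F j)%:R.
have [ch H] := balanced_coloring a wt0 wt1.
exists ch => j c; apply: ler_norm_sqr; first by rewrite mulr_ge0.
have -> : #|F j :&: [set v | ch v == c]|%:R = \sum_(t | ch t == c) a t j.
  rewrite -sum1_card natr_sum big_mkcond [RHS]big_mkcond; apply: eq_bigr => v _.
  by rewrite !inE /a; case: (v \in F j); case: (ch v == c).
have -> : #|F j|%:R = \sum_t a t j.
  rewrite -sum1_card natr_sum big_mkcond; apply: eq_bigr => v _.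
  by rewrite /a; case: (v \in F j).
apply: (@le_trans _ _ (2 * \sum_t \sum_j a t j ^+ 2)).
  apply: le_trans H; rewrite (bigD1 j) //= (bigD1 c) //= -addrA lerDl addr_ge0 //.
    by apply: sumr_ge0 => *; exact: sqr_ge0.
  by apply: sumr_ge0 => *; apply: sumr_ge0 => *; exact: sqr_ge0.
apply: (@le_trans _ _ (2 * (#|J|%:R * #|V|%:R))).
  rewrite ler_pM2l //; have -> : #|J|%:R * #|V|%:R = \sum_(t : V) \sum_(j : J) (1 : R).
    by rewrite !sumr_const mulr_natr.
  apply: ler_sum => t _; apply: ler_sum => i _.
  by rewrite /a; case: (t \in F i); rewrite ?expr1n ?expr0n.
by rewrite mulrA exprMn expr2 mulrA ler_wpM2r // -expr2.
Qed.

Lemma divnD1 d x : (0 < d)%N -> ((x + d) %/ d = (x %/ d).+1)%N.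
Proof. by move=> d0; rewrite divnDr ?dvdnn // divnn d0 addn1. Qed.

Section ChunkAssignment.
Variables (R : realFieldType) (V : finType) (lab : V -> nat) (col : V -> bool).
Variables (m : nat) (conn : rel 'I_m) (wt : 'I_m -> R) (ell b K : nat).
Hypotheses (lab_inj : injective lab) (lab_lt : forall v, (lab v < #|V|)%N).
Hypotheses (connC : forall i j, connect conn i j) (conn_refl : reflexive conn).
Hypotheses (wt0 : forall i, 0 <= wt i) (wt1 : \sum_i wt i = 1).
Hypotheses (ell0 : (0 < ell)%N) (bm : (m + 2 <= b)%N) (K0 : (0 < K)%N).
Hypothesis bigK : (#|V| <= K * (b * ell))%N.

Let b0 : (0 < b)%N. Proof. by apply: leq_trans bm; rewrite addn2. Qed.
Let blk v := (lab v %/ ell %/ b)%N.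

Let blk_lt v : (blk v < K)%N.
Proof.
rewrite /blk -divnMA ltn_divLR ?muln_gt0 ?ell0 // [(ell * b)%N]mulnC.
exact: leq_trans (lab_lt v) bigK.
Qed.

Lemma card_label_le (P : pred nat) (A : {set V}) (k : nat) (g : nat -> 'I_k) :
  (forall v, v \in A -> P (lab v)) -> (forall x y, P x -> P y -> g x = g y -> x = y) -> (#|A| <= k)%N.
Proof.
move=> AP ginj; rewrite -[k in leqRHS]card_ord -(card_in_imset (f := g \o lab)) ?max_card //.
by move=> v w vA wA /= /(ginj _ _ (AP _ vA) (AP _ wA)) /lab_inj.
Qed.

Let divmod_inj d x y : (x %/ d = y %/ d -> x %% d = y %% d -> x = y)%N.
Proof. by move=> h1 h2; rewrite (divn_eq x d) (divn_eq y d) h1 h2. Qed.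

Lemma blk_card k : (#|[set v | blk v == k]| <= b * ell)%N.
Proof.
pose g x : 'I_(b * ell) := Ordinal (ltac:(by rewrite ltn_pmod // muln_gt0 b0) : (x %% (b * ell) < b * ell)%N).
apply: (@card_label_le (fun x => x %/ ell %/ b == k)%N [set v | blk v == k] _ g) => [v|x y].
  by rewrite inE.
move=> /eqP hx /eqP hy [] h; apply: (@divmod_inj (b * ell)) => //.
by rewrite ![(b * ell)%N]mulnC !divnMA hx hy.
Qed.

(** The transitional vertices. A walk ends by position [m], so outside positions [0] to [m + 1] and
    the last one, an interval and both its neighbours carry the cluster of their block. *)
Let Tr := [set v | (lab v %/ ell %% b <= m + 1)%N || ((lab v %/ ell %% b).+1 == b)].

Let Tr_card : (#|Tr| <= K * (m + 3) * ell)%N.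
Proof.
pose T := ('I_K * 'I_(m + 3) * 'I_ell)%type.
have -> : (K * (m + 3) * ell)%N = #|{: T}| by rewrite !card_prod !card_ord.
pose pos r := if (r <= m + 1)%N then r else (m + 2)%N.
have pos_lt r : (pos r < m + 3)%N by rewrite /pos; case: ifP; lia.
pose h v : T := (Ordinal (blk_lt v), Ordinal (pos_lt (lab v %/ ell %% b)%N),
  Ordinal (ltac:(by rewrite ltn_pmod) : (lab v %% ell < ell)%N)).
rewrite -(card_in_imset (f := h)) ?max_card // => v w; rewrite !inE => hv hw [] h1 h2 h3.
apply: lab_inj; apply: (@divmod_inj ell) => //; apply: (@divmod_inj b) => //.
move: h2 hv hw; rewrite /pos; case: leqP => ?; case: leqP => ? //=; lia.
Qed.

(* Block [k] consists of [b] intervals of [ell] labels: it walks along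
   [conn] from the cluster of block [k - 1] to its own cluster, then stays there. *)
Lemma chunk_assignment (e : R) : 0 <= e -> 2 * (b * ell)%:R * #|V|%:R <= e ^+ 2 ->
  exists (sg : nat -> 'I_m) (Tr : {set V}), let s v := sg (lab v %/ ell)%N in
  [/\ forall q, conn (sg q) (sg q.+1), (#|Tr| <= K * (m + 3) * ell)%N,
    forall v w, v \notin Tr -> (lab v <= lab w + ell)%N -> (lab w <= lab v + ell)%N -> s w = s v &
    forall c i, `| #|[set v | (col v == c) && (s v == i)]|%:R - wt i * #|[set v | col v == c]|%:R |
      <= e + #|Tr|%:R].
Proof.
move=> e0 le.
(* The coloured items are whole blocks, with one coordinate per colour class. Each entry is at most
   [b * ell] and all entries sum to [#|V|], which bounds the sum of squares. *)
pose a (k : 'I_K) (c : bool) : R := #|[set v | (col v == c) && (blk v == k)]|%:R.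
have [ch H] := balanced_coloring a wt0 wt1.
pose J k := ch (insubd (Ordinal K0) k).
have ex k : exists p : seq 'I_m, [&& path conn (J k.-1) p, last (J k.-1) p == J k & (size p <= m)%N].
  have /connectP[p0 pth lst] := connC (J k.-1) (J k).
  case/shortenP: pth lst => p pth /= /andP[_ u] _ lst; exists p; rewrite pth lst eqxx /=.
  by rewrite -(card_uniqP u) -[leqRHS]card_ord max_card.
pose P k := xchoose (ex k).
have HP k : [/\ path conn (J k.-1) (P k), last (J k.-1) (P k) = J k & (size (P k) <= m)%N].
  by have /and3P[? /eqP ? ?] := xchooseP (ex k).
(* Position [0] repeats the cluster of the previous block (its own in block [0]), which makes the
   border between blocks a reflexive step; the default of [nth] is the stay after the walk. *)
pose sg q := nth (J (q %/ b)%N) (J (q %/ b).-1 :: P (q %/ b)%N) (q %% b)%N.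
have sg_late q : (m < q %% b)%N -> sg q = J (q %/ b)%N.
  by move=> lt; rewrite /sg nth_default //=; have [_ _ sz] := HP (q %/ b)%N; apply: leq_ltn_trans sz lt.
have s_main v : v \notin Tr -> sg (lab v %/ ell)%N = J (blk v).
  by rewrite inE negb_or -ltnNge => /andP[lt _]; apply: sg_late; lia.
exists sg, Tr; split=> //.
- move=> q; have [pth lst sz] := HP (q %/ b)%N.
  have lt : (q %% b < b)%N by rewrite ltn_pmod.
  have [lt2|ge2] := ltnP (q %% b).+1 b.
    have dq : (q.+1 %/ b = q %/ b)%N.
      by rewrite [in LHS](divn_eq q b) -addnS divnMDl // (divn_small lt2) addn0.
    have mq : (q.+1 %% b = (q %% b).+1)%N.
      by rewrite [in LHS](divn_eq q b) -addnS modnMDl (modn_small lt2).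
    rewrite /sg dq mq.
    have [lt3|ge3] := ltnP (q %% b) (size (P (q %/ b)%N)).
      by have /(pathP (J (q %/ b)%N)) := pth; apply.
    rewrite [X in conn _ X]nth_default //.
    have [lt4|ge4] := ltnP (size (P (q %/ b)%N)) (q %% b); first by rewrite nth_default.
    have -> : (q %% b)%N = size (P (q %/ b)%N) by lia.
    by rewrite nth_last /= lst.
  have eb : (q %% b).+1 = b by lia.
  have dq : (q.+1 %/ b = (q %/ b).+1)%N.
    by rewrite [in LHS](divn_eq q b) -addnS eb -mulSnr mulnK.
  have mq : (q.+1 %% b = 0)%N.
    by rewrite [in LHS](divn_eq q b) -addnS eb -mulSnr modnMl.
  by rewrite sg_late; [rewrite /sg dq mq /= | lia].
- move=> v w vT lvw lwv; rewrite (s_main v vT).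
  set q := (lab v %/ ell)%N; set q' := (lab w %/ ell)%N.
  have le1 : (q <= q' + 1)%N.
    by rewrite /q /q' addn1 -(divnD1 _ ell0) leq_div2r.
  have le2 : (q' <= q + 1)%N.
    by rewrite /q /q' addn1 -(divnD1 _ ell0) leq_div2r.
  move: vT; rewrite inE negb_or -/q -ltnNge => /andP[lt1 ne].
  have lt : (q %% b < b)%N by rewrite ltn_pmod.
  have [d m'] : (q' %/ b = q %/ b)%N /\ (m < q' %% b)%N.
    have eq' : q' = (q %/ b * b + (q %% b + q' - q))%N.
      have := divn_eq q b; move: lt1 le1 le2; set Z := (q %/ b * b)%N; set r := (q %% b)%N.
      by clearbody q q' Z r; lia.
    have small : (q %% b + q' - q < b)%N by lia.
    by rewrite eq' divnMDl // (divn_small small) addn0 modnMDl (modn_small small); split=> //; lia.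
  by rewrite sg_late // d.
- move=> c i.
  pose M := [set v | (col v == c) && (J (blk v) == i)].
  have main : `| #|M|%:R - wt i * #|[set v | col v == c]|%:R | <= e.
    have part (A : {set V}) : #|A| = (\sum_(k < K) #|[set v in A | blk v == k]|)%N.
      rewrite -sum1_card (partition_big (fun v => Ordinal (blk_lt v)) xpredT) //=.
      apply: eq_bigr => k _; rewrite sum1_card; apply: eq_card => v.
      by rewrite !inE.
    have eM : #|M|%:R = \sum_(k | ch k == i) a k c.
      rewrite (part M) natr_sum [RHS]big_mkcond; apply: eq_bigr => k _.
      have sub v : blk v = k -> J (blk v) = ch k.
        by move=> h; rewrite /J h; congr ch; apply: val_inj; rewrite val_insubd ltn_ord.
      case: eqP => [ek|nek].
        congr (_%:R); apply: eq_card => v; rewrite !inE -andbA; case: (_ == c) => //=.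
        by case: (blk v =P k) => [/sub ->|]; rewrite ?andbF // ek eqxx.
      apply/eqP; rewrite pnatr_eq0 cards_eq0; apply/eqP/setP => v; rewrite !inE.
      case: (blk v =P k) => [/sub ->|_]; last by rewrite andbF.
      by rewrite (introF eqP nek) andbF.
    have eC : #|[set v | col v == c]|%:R = \sum_k a k c.
      rewrite (part _) natr_sum; apply: eq_bigr => k _; congr (_%:R).
      by apply: eq_card => v; rewrite !inE.
    apply: ler_norm_sqr => //; rewrite eM eC; apply: le_trans le.
    apply: (@le_trans _ _ (2 * \sum_k \sum_c a k c ^+ 2)).
      apply: le_trans H; rewrite (bigD1 c) //= (bigD1 i) //= -addrA lerDl addr_ge0 //.
        by apply: sumr_ge0 => *; exact: sqr_ge0.
      by apply: sumr_ge0 => *; apply: sumr_ge0 => *; exact: sqr_ge0.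
    rewrite -mulrA ler_pM2l // .
    have -> : #|V|%:R = \sum_(k < K) \sum_c a k c.
      rewrite -cardsT (part _) natr_sum; apply: eq_bigr => k _; rewrite big_bool /= -natrD.
      congr (_%:R); rewrite -(cardsID [set v | col v == true]); congr (_ + _)%N; apply: eq_card => v.
        by rewrite !inE andbC.
      by rewrite !inE; case: (col v).
    rewrite mulr_sumr; apply: ler_sum => k _; rewrite mulr_sumr; apply: ler_sum => d _.
    rewrite expr2 ler_wpM2r ?ler0n // ler_nat; apply: leq_trans (blk_card k).
    by apply: subset_leq_card; apply/subsetP => v; rewrite !inE => /andP[].
  set S := [set v | (col v == c) && _].
  have le1 : (#|S| <= #|M| + #|Tr|)%N.
    apply: leq_trans (leq_card_setU _ _).1; apply: subset_leq_card; apply/subsetP => v vS.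
    rewrite in_setU; case: (boolP (v \in Tr)) => [_|/s_main h]; first by rewrite orbT.
    by move: vS; rewrite !inE h orbF.
  have le2 : (#|M| <= #|S| + #|Tr|)%N.
    apply: leq_trans (leq_card_setU _ _).1; apply: subset_leq_card; apply/subsetP => v vS.
    rewrite in_setU; case: (boolP (v \in Tr)) => [_|/s_main h]; first by rewrite orbT.
    by move: vS; rewrite !inE h orbF.
  move: le1 le2 main; rewrite -!(ler_nat R) !natrD !ler_norml; lra.
Qed.

End ChunkAssignment.

(** * Embedding one colour class *)

Section Embedding.
Variables (R : realFieldType) (V : finType) (G L : rel V) (m : nat).
Variables (Vc Uc : 'I_m -> {set V}) (s : V -> 'I_m) (X Main Ys VX VR : {set V}) (D kst : nat).
Variables (rho eps eps1 eps2 gam g p a B : R).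
Hypothesis sys : cluster_system G rho eps eps1 gam Vc Uc.
Hypotheses (symL : symmetric L) (degL : forall v, (#|nb L v| <= D)%N).
Hypothesis bipL : forall x y, L x y -> (x \in X) != (y \in X).
Hypothesis mainP : forall y x, y \in Main -> L y x -> s x = s y.
Hypotheses (sYs : Ys \subset Main) (YsX : forall y, y \in Ys -> y \notin X).
Hypothesis Ys_disj : forall y y' x, y \in Ys -> y' \in Ys -> L y x -> L y' x -> y = y'.
Let n : R := #|V|%:R.
Let Sp := \bigcup_(y in Ys) nb L y.
Let base y : {set V} := VR :&: \bigcap_(x in nb L y) Uc (s x).
Hypothesis disjVR : [disjoint VX & VR].
Hypotheses (rho0 : 0 < rho) (rho1 : rho <= 1) (eps0 : 0 <= eps) (eps20 : 0 <= eps2) (p0 : 0 <= p) (p1 : p <= 1).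
Hypotheses (a0 : 0 < a) (ap : a <= p) (g1 : g <= 1) (B1 : 1 <= B).
Hypothesis base_large : forall y, y \notin X -> eps1 * n <= rho ^+ D * #|base y|%:R.
Hypothesis eps2_large : eps1 <= rho ^+ D * eps2.
Hypothesis avail_special : forall i, #|[set x in Sp | s x == i]|%:R + #|VR :&: Vc i|%:R +
  D%:R * (eps * #|Vc i|%:R) + p * #|Vc i|%:R <= g * #|Vc i|%:R.
Hypothesis avail : forall i, #|[set x in X | s x == i]|%:R +
  D%:R * (eps * #|Vc i|%:R) + a * #|Vc i|%:R <= #|Vc i :&: VX|%:R.
Hypothesis epsB : D%:R * eps * B ^+ D <= a.
Hypothesis Vc0 : forall i, (0 < #|Vc i|)%N.

Definition cand (C : {set V}) (f : V -> V) (P : {set V}) (y : V) : {set V} :=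
  [set v in C | [forall x in nb L y :&: P, G (f x) v]].

Definition upd (f : V -> V) (x v z : V) : V := if z == x then v else f z.

Definition good (w : V) (i : 'I_m) : bool := g * #|Vc i|%:R <= #|nb G w :&: Vc i|%:R.

(** Having fewer candidates than the typical share, rather than none, is a condition that can be
    followed step by step: a living [y] dies only when a new image is thin towards its current
    candidates, which are still numerous. *)
Definition dead_set (T : {set V}) (f : V -> V) (P : {set V}) : {set V} :=
  [set y in Main | (eps2 * n <= #|T :&: Uc (s y)|%:R) &&
    (#|cand (T :&: Uc (s y)) f P y|%:R < rho ^+ #|nb L y :&: P| * #|T :&: Uc (s y)|%:R)].

(* Conditional probability, up to the factor 1/2 and a lower bound [p] on each
   step, that all neighbours of [y] end up in the neighbourhood of [w]. *)
Definition hit_weight (w : V) (f : V -> V) (P : {set V}) (y : V) : R :=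
  if good w (s y) && [forall x in nb L y :&: P, G w (f x)]
  then 1 - p ^+ #|nb L y :\: P| / 2 else 1.

(** After all of [X] is placed, a special [y] in a good cluster that [w] can host weighs [1 / 2], so
    the summand of [w] controls [(1 / 2)] to the number of special [y] hosted by [w]. *)
Definition hit_potential f P : R := \sum_w \prod_(y in Ys) hit_weight w f P y.
(** An exponential moment: a large [B] outweighs both the [2 ^ #|V|] sets [T] and a doubling for
    every placed vertex. *)
Definition dead_potential f P : R := \sum_(T : {set V}) B ^+ #|dead_set T f P|.

Definition partial_ok (f : V -> V) (P : {set V}) : Prop :=
  [/\ {in P &, injective f}, forall x, x \in P -> [/\ f x \in Vc (s x), f x \notin VR &
      x \notin Sp -> f x \in VX] &
    forall y, y \notin X -> rho ^+ #|nb L y :&: P| * #|base y|%:R <= #|cand (base y) f P y|%:R].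

Section Step.
Variables (f : V -> V) (P : {set V}) (x : V).
Hypotheses (xX : x \in X) (xP : x \notin P) (PX : P \subset X).
Hypothesis PSp : x \in Sp -> P \subset Sp.

Lemma updE v z : z \in P -> upd f x v z = f z.
Proof. by rewrite /upd; case: eqP => // ->; rewrite (negPf xP). Qed.

Lemma upd_self v : upd f x v x = v.
Proof. by rewrite /upd eqxx. Qed.

Lemma nb_step_in y : L y x -> nb L y :&: (x |: P) = x |: (nb L y :&: P).
Proof. by move=> Lyx; apply/setP => z; rewrite !inE; case: eqP => // ->; rewrite Lyx. Qed.

Lemma nb_step_out y : ~~ L y x -> nb L y :&: (x |: P) = nb L y :&: P.
Proof. by move=> nL; apply/setP => z; rewrite !inE; case: eqP => // ->; rewrite (negPf nL). Qed.

Lemma card_step_in y : L y x -> #|nb L y :&: (x |: P)| = #|nb L y :&: P|.+1.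
Proof. by move/nb_step_in->; rewrite cardsU1 !inE (negPf xP) andbF. Qed.

Lemma forall_step_in v (K : rel V) y (u : V) : L y x ->
  [forall z in nb L y :&: (x |: P), K u (upd f x v z)] =
  [forall z in nb L y :&: P, K u (f z)] && K u v.
Proof.
move=> Lyx; apply/forall_inP/andP => [h|[/forall_inP h Kv] z].
  split; last by have := h x; rewrite upd_self !inE Lyx eqxx; apply.
  apply/forall_inP => z; rewrite inE => /andP[zy zP].
  by have := h z; rewrite updE // !inE zP orbT andbT; apply; rewrite inE in zy.
rewrite nb_step_in // in_setU1 => /orP[/eqP->|zP]; first by rewrite upd_self.
by rewrite updE ?h //; move: zP; rewrite inE => /andP[].
Qed.

Lemma forall_step_out v (K : rel V) y (u : V) : ~~ L y x ->
  [forall z in nb L y :&: (x |: P), K u (upd f x v z)] = [forall z in nb L y :&: P, K u (f z)].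
Proof.
move=> nL; rewrite nb_step_out //; apply: eq_forallb_in => z.
by rewrite inE => /andP[_ zP]; rewrite updE.
Qed.

Lemma cand_step_in v C y : L y x -> cand C (upd f x v) (x |: P) y = nb G v :&: cand C f P y.
Proof.
move=> Lyx; apply/setP => u; rewrite !inE (@forall_step_in v (fun a b => G b a)) //.
by rewrite andbA andbC.
Qed.

Lemma cand_step_out v C y : ~~ L y x -> cand C (upd f x v) (x |: P) y = cand C f P y.
Proof.
by move=> nL; apply/setP => u; rewrite !inE (@forall_step_out v (fun a b => G b a)).
Qed.

Lemma thin_small (C : {set V}) : C \subset Uc (s x) -> eps1 * n <= #|C|%:R ->
  #|thin G rho C (Vc (s x))|%:R <= eps * #|Vc (s x)|%:R.
Proof. by have [_ _ _ see] := sys; exact: see. Qed.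

Lemma card_bigcup_thin (Q : {set V}) (F : V -> {set V}) : Q \subset nb L x ->
  (forall y, y \in Q -> #|F y|%:R <= eps * #|Vc (s x)|%:R) ->
  #|\bigcup_(y in Q) F y|%:R <= D%:R * (eps * #|Vc (s x)|%:R).
Proof.
move=> sQ le; apply: (@le_trans _ _ (\sum_(y in Q) #|F y|%:R)).
  rewrite -natr_sum ler_nat; elim/big_ind2: _ => [|A k A' k' h h'|//]; first by rewrite cards0.
  by apply: leq_trans (leq_card_setU _ _).1 _; apply: leq_add.
apply: (@le_trans _ _ (\sum_(y in Q) eps * #|Vc (s x)|%:R)); first exact: ler_sum.
rewrite sumr_const -[leLHS]mulr_natl ler_wpM2r ?mulr_ge0 ?ler0n // ler_nat.
exact: leq_trans (subset_leq_card sQ) (degL x).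
Qed.

Hypothesis ok : partial_ok f P.

(** A neighbour of a special vertex has to be able to land in [nb G w] for every good [w]. Since
    [VX] is balanced only on boundedly many sets, such a vertex may use the whole cluster outside
    [VR]. *)
Let home := if x \in Sp then Vc (s x) :\: VR else Vc (s x) :&: VX.
Let bad := \bigcup_(y in nb L x) thin G rho (cand (base y) f P y) (Vc (s x)).
Let choices := (home :\: f @: P) :\: bad.

Let nbx y : y \in nb L x -> L y x /\ y \notin X.
Proof. by rewrite inE => Lxy; split; [rewrite symL|move: (bipL Lxy); rewrite xX; case: (y \in X)]. Qed.

Lemma rho_pow_le k j : (k <= j)%N -> rho ^+ j <= rho ^+ k.
Proof. by move=> kj; rewrite ler_wiXn2l // ltW. Qed.

Lemma card_nbI y (Q : {set V}) : (#|nb L y :&: Q| <= D)%N.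
Proof. exact: leq_trans (subset_leq_card (subsetIl _ _)) (degL y). Qed.

Lemma bad_small : #|bad|%:R <= D%:R * (eps * #|Vc (s x)|%:R).
Proof.
apply: card_bigcup_thin => // y /nbx[Lyx yX]; apply: thin_small.
  apply/subsetP => v; rewrite !inE => /andP[/andP[_ /bigcapP h] _].
  by apply: h; rewrite inE.
have [_ _ ok3] := ok; apply: le_trans (ok3 y yX); apply: le_trans (base_large yX) _.
by rewrite ler_wpM2r // rho_pow_le // card_nbI.
Qed.

Lemma choices_ok v : v \in choices -> partial_ok (upd f x v) (x |: P).
Proof.
rewrite !inE => /and3P[vbad vfP vhome]; have [ok1 ok2 ok3] := ok; split.
- move=> z z'; rewrite !in_setU1 => /orP[/eqP->|zP] /orP[/eqP->|zP'] //.
  + by rewrite upd_self updE // => e; case/imsetP: vfP; exists z'.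
  + by rewrite upd_self updE // => e; case/imsetP: vfP; exists z.
  + by rewrite !updE //; exact: ok1.
- move=> z; rewrite in_setU1 => /orP[/eqP->|zP]; last by rewrite updE //; exact: ok2.
  rewrite upd_self; move: vhome; rewrite /home; case: ifP => _; rewrite inE => /andP[h1 h2].
    by split.
  by split=> //; apply: contraTN h2 => vR; rewrite (disjointFl disjVR vR).
- move=> y yX; case: (boolP (L y x)) => Lyx; last by rewrite nb_step_out // cand_step_out // ok3.
  rewrite cand_step_in // card_step_in // exprS -mulrA.
  apply: le_trans (_ : rho * #|cand (base y) f P y|%:R <= _).
    by rewrite ler_pM2l // ok3.
  rewrite leNgt; apply: contra vbad => lt; apply/bigcupP; exists y; first by rewrite inE symL.
  rewrite inE lt andbT; move: vhome; rewrite /home; case: ifP => _; rewrite inE => /andP[] //.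
Qed.

Lemma used_small (S : {set V}) : P \subset S ->
  (#|Vc (s x) :&: f @: P| <= #|[set z in S | s z == s x]|)%N.
Proof.
move=> PS; have [disj _ _ _] := sys; have [_ ok2 _] := ok.
apply: leq_trans (leq_imset_card f _); apply: subset_leq_card.
apply/subsetP => v; rewrite inE => /andP[vi /imsetP[z zP e]]; apply/imsetP; exists z => //.
rewrite inE (subsetP PS) //=; apply: contraTT vi => ne.
have [fz _ _] := ok2 z zP.
by rewrite e; have := disj _ _ ne => /disjointFr->.
Qed.

Lemma card_choices (A : {set V}) :
  #|A :&: home|%:R <= #|A :&: choices|%:R + #|Vc (s x) :&: f @: P|%:R + #|bad|%:R :> R.
Proof.
rewrite -!natrD ler_nat; apply: leq_trans (_ : #|A :&: choices :|: (Vc (s x) :&: f @: P) :|: bad| <= _)%N.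
  apply: subset_leq_card; apply/subsetP => v; rewrite inE => /andP[vA vh].
  have vi : v \in Vc (s x) by move: vh; rewrite /home; case: ifP => _; rewrite inE => /andP[].
  rewrite !in_setU in_setI vA in_setI vi !in_setD vh.
  by case: (v \in bad); case: (v \in f @: P).
by apply: leq_trans (leq_card_setU _ _).1 _; rewrite leq_add2r (leq_card_setU _ _).1.
Qed.

Lemma choices_large : a * #|Vc (s x)|%:R <= #|choices|%:R.
Proof.
have := card_choices setT; rewrite !setTI => h; have hb := bad_small.
have Vn : 0 <= #|Vc (s x)|%:R :> R by rewrite ler0n.
move: h; rewrite /home; case: ifP => [xSp|_] h.
  have := used_small (PSp xSp); rewrite -(ler_nat R); have := avail_special (s x).
  have := cardsID VR (Vc (s x)) => /(congr1 (fun k => k%:R : R)); rewrite natrD setIC.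
  by have := ler_wpM2r Vn ap; have := ler_wpM2r Vn g1; move: h hb; lra.
have := used_small PX; rewrite -(ler_nat R); have := avail (s x).
by move: h hb; lra.
Qed.

(** This is the conditional probability [p] behind [hit_weight]. It relies on placing [Sp] first:
    only images of [Sp], the reservoir [VR] and thin vertices are then removed from the cluster. *)
Lemma choices_hit w : x \in Sp -> good w (s x) -> p * #|choices|%:R <= #|nb G w :&: choices|%:R.
Proof.
move=> xSp gd; apply: (@le_trans _ _ (p * #|Vc (s x)|%:R)).
  rewrite ler_wpM2l // ler_nat subset_leq_card //; apply/subsetP => v; rewrite !inE.
  by case/and3P=> _ _; rewrite /home xSp inE => /andP[].
have := card_choices (nb G w); have hb := bad_small.
rewrite /home xSp => h; have := used_small (PSp xSp); rewrite -(ler_nat R).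
have := avail_special (s x); move: gd; rewrite /good.
have : #|nb G w :&: Vc (s x)|%:R <= #|nb G w :&: (Vc (s x) :\: VR)|%:R + #|VR :&: Vc (s x)|%:R :> R.
  rewrite -natrD ler_nat; apply: leq_trans (leq_card_setU _ _).1; apply: subset_leq_card.
  by apply/subsetP => v; rewrite !inE => /andP[-> ->]; case: (v \in VR).
by move: h hb; lra.
Qed.

Lemma hit_weight_ge0 w f' P' y : 0 <= hit_weight w f' P' y.
Proof.
rewrite /hit_weight; case: ifP => // _; have := @exprn_ile1 _ #|nb L y :\: P'| p p0 p1.
by lra.
Qed.

(** The neighbourhoods of special vertices are disjoint, so [x] affects a single factor [y0]. A
    share of at least [p] of the choices lies in [nb G w] and replaces [p ^ k] by [p ^ k.-1]; the
    others reset the weight to [1]. The average does not increase. *)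
Lemma hit_potential_step :
  \sum_(v in choices) hit_potential (upd f x v) (x |: P) <= #|choices|%:R * hit_potential f P.
Proof.
rewrite /hit_potential exchange_big /= mulr_sumr; apply: ler_sum => w _.
have out v y : ~~ L y x -> hit_weight w (upd f x v) (x |: P) y = hit_weight w f P y.
  move=> nL; rewrite /hit_weight forall_step_out //.
  have -> // : nb L y :\: (x |: P) = nb L y :\: P.
  by apply/setP => z; rewrite !inE; case: eqP => // ->; rewrite (negPf nL) !andbF.
case: (boolP (x \in Sp)) => [xSp|nSp]; last first.
  rewrite mulr_natl -sumr_const; apply: ler_sum => v _; rewrite le_eqVlt; apply/orP; left; apply/eqP.
  apply: eq_bigr => y yYs; apply: out; apply: contra nSp => Lyx.
  by apply/bigcupP; exists y; rewrite ?inE.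
have /bigcupP[y0 y0Ys] := xSp; rewrite inE => Ly0x.
have y0M : y0 \in Main by apply: (subsetP sYs).
rewrite [X in _ <= _ * X](bigD1 y0) //= mulrA.
have eqr v : \prod_(y in Ys) hit_weight w (upd f x v) (x |: P) y =
    hit_weight w (upd f x v) (x |: P) y0 * \prod_(y in Ys | y != y0) hit_weight w f P y.
  rewrite (bigD1 y0) //=; congr (_ * _); apply: eq_bigr => y /andP[yYs ne].
  by apply: out; apply: contra ne => Lyx; rewrite (Ys_disj yYs y0Ys Lyx Ly0x).
under eq_bigr do rewrite eqr.
rewrite -mulr_suml ler_wpM2r //; first by apply: prodr_ge0 => y _; exact: hit_weight_ge0.
have -> : \sum_(v in choices) hit_weight w (upd f x v) (x |: P) y0 =
   \sum_(v in choices) (if good w (s y0) && [forall z in nb L y0 :&: P, G w (f z)] && G w v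
      then 1 - p ^+ #|nb L y0 :\: P|.-1 / 2 else 1).
  apply: eq_bigr => v _; rewrite /hit_weight forall_step_in // andbA.
  have -> // : #|nb L y0 :\: (x |: P)| = #|nb L y0 :\: P|.-1.
  rewrite (cardsD1 x (nb L y0 :\: P)) !inE Ly0x xP /=; apply: eq_card => z.
  by rewrite !inE negb_or andbA.
rewrite /hit_weight; case: ifP => [/andP[gd _]|_] /=; last by rewrite sumr_const mulr1.
set k := #|nb L y0 :\: P|.
have k0 : (0 < k)%N by rewrite /k (cardsD1 x) !inE Ly0x xP.
have -> : \sum_(v in choices) (if G w v then 1 - p ^+ k.-1 / 2 else 1) =
    #|choices|%:R - #|nb G w :&: choices|%:R * (p ^+ k.-1 / 2) :> R.
  have -> : #|nb G w :&: choices|%:R * (p ^+ k.-1 / 2) =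
      \sum_(v in choices) (if G w v then p ^+ k.-1 / 2 else 0).
    rewrite -big_mkcondr /= mulr_natl -sumr_const; apply: eq_bigl => v.
    by rewrite !inE andbC.
  rewrite -sum1_card natr_sum -sumrB; apply: eq_bigr => v _.
  by case: ifP => _; rewrite ?subr0.
have q0 : 0 <= p ^+ k.-1 / 2 by rewrite divr_ge0 ?exprn_ge0.
have := ler_wpM2r q0 (choices_hit xSp (_ : good w (s x))).
rewrite (mainP y0M Ly0x) => /(_ gd); have -> : p ^+ k = p * p ^+ k.-1 by rewrite -exprS prednK.
lra.
Qed.

(** For fixed [T], a living [y] next to [x] has at least [eps1 * n] candidates in [T], so at most
    [D * eps * #|Vc (s x)|] choices kill any such [y], and each kills at most [D]. The average
    factor is at most [1 + D * eps * B ^ D / a], that is at most [2]. *)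
Lemma dead_potential_step :
  \sum_(v in choices) dead_potential (upd f x v) (x |: P) <= 2 * #|choices|%:R * dead_potential f P.
Proof.
rewrite /dead_potential exchange_big /= mulr_sumr; apply: ler_sum => T _.
pose Q := [set y in nb L x | [&& y \in Main, eps2 * n <= #|T :&: Uc (s y)|%:R & y \notin dead_set T f P]].
pose thinT y := thin G rho (cand (T :&: Uc (s y)) f P y) (Vc (s x)).
pose inc v := #|[set y in Q | v \in thinT y]|.
have B0 : 0 <= B by apply: le_trans B1.
have Q_small : #|\bigcup_(y in Q) thinT y|%:R <= D%:R * (eps * #|Vc (s x)|%:R).
  apply: card_bigcup_thin => [|y]; first by apply/subsetP => y; rewrite inE => /andP[].
  rewrite inE => /andP[/nbx[Lyx yX] /and3P[yM big nd]].
  apply: thin_small.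
    rewrite (mainP yM Lyx); apply/subsetP => v; rewrite inE => /andP[+ _].
    by rewrite inE => /andP[].
  move: nd; rewrite inE yM big /= -leNgt; apply: le_trans.
  apply: (@le_trans _ _ (rho ^+ D * (eps2 * n))).
    by rewrite mulrA ler_wpM2r // ler0n.
  apply: ler_pM => //; first by rewrite exprn_ge0 // ltW.
    by rewrite mulr_ge0 // ler0n.
  by rewrite rho_pow_le // card_nbI.
have dead_le v : v \in choices -> (#|dead_set T (upd f x v) (x |: P)| <= #|dead_set T f P| + inc v)%N.
  move=> vC; apply: leq_trans (leq_card_setU _ _).1; apply: subset_leq_card; apply/subsetP => y.
  rewrite in_setU; case: (boolP (y \in dead_set T f P)) => //= nd; rewrite [_ \in dead_set _ _ _]inE.
  case/and3P=> yM big lt; case: (boolP (L y x)) => Lyx; last first.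
    by case/negP: nd; rewrite inE yM big; move: lt; rewrite nb_step_out // cand_step_out.
  have vi : v \in Vc (s x).
    by move: vC; rewrite !inE /home => /and3P[_ _]; case: ifP => _; rewrite inE => /andP[].
  rewrite inE; apply/andP; split; first by rewrite inE inE symL Lyx yM big nd.
  rewrite inE vi /=; move: lt; rewrite cand_step_in // card_step_in // exprS -mulrA => lt.
  apply: lt_le_trans lt _; rewrite ler_pM2l //.
  by move: nd; rewrite inE yM big /= -leNgt.
have inc_le v : (inc v <= D)%N.
  apply: leq_trans (degL x); apply: subset_leq_card; apply/subsetP => y.
  by rewrite !inE => /andP[/andP[]].
have step v : v \in choices -> B ^+ #|dead_set T (upd f x v) (x |: P)| <=
    B ^+ #|dead_set T f P| * (1 + (v \in \bigcup_(y in Q) thinT y)%:R * B ^+ D).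
  move=> vC; apply: (@le_trans _ _ (B ^+ (#|dead_set T f P| + inc v))).
    by rewrite ler_weXn2l // dead_le.
  rewrite exprD ler_wpM2l ?exprn_ge0 //.
  case: (boolP (v \in _)) => [_|nv].
    by rewrite mul1r; have := ler_weXn2l B1 (inc_le v); lra.
  have -> : inc v = 0%N; last by rewrite expr0 mul0r addr0.
  apply/eqP; rewrite cards_eq0; apply/eqP/setP => y; rewrite inE in_set0.
  by apply: contraNF nv => /andP[yQ vy]; apply/bigcupP; exists y.
apply: le_trans (ler_sum _ step) _; rewrite -mulr_sumr mulrC.
rewrite ler_wpM2r ?exprn_ge0 // big_split /= sumr_const -mulr_suml.
have sm : \sum_(v in choices) (v \in \bigcup_(y in Q) thinT y)%:R <= D%:R * (eps * #|Vc (s x)|%:R) :> R.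
  apply: le_trans Q_small; rewrite -natr_sum ler_nat -sum1_card big_mkcond [leqRHS]big_mkcond.
  by apply: leq_sum => v _; case: (v \in choices); case: (v \in _).
have := ler_wpM2r (exprn_ge0 D B0) sm.
have := ler_wpM2r (ler0n R #|Vc (s x)|) epsB; have := choices_large; lra.
Qed.

(** Halving the coefficient of [dead_potential] absorbs its doubling, so one averaging serves both
    potentials. *)
Lemma embedding_step (c1 c3 : R) : 0 <= c1 -> 0 <= c3 ->
  exists2 v, partial_ok (upd f x v) (x |: P) &
    c1 * hit_potential (upd f x v) (x |: P) + c3 / 2 * dead_potential (upd f x v) (x |: P) <=
    c1 * hit_potential f P + c3 * dead_potential f P.
Proof.
move=> c10 c30.
have [||v vC le] := @exists_le_avg R V choices
  (fun v => c1 * hit_potential (upd f x v) (x |: P) + c3 / 2 * dead_potential (upd f x v) (x |: P))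
  (c1 * hit_potential f P + c3 * dead_potential f P).
- rewrite -(ltr0n R); apply: lt_le_trans choices_large.
  by rewrite mulr_gt0 // ltr0n.
- rewrite big_split /= -!mulr_sumr.
  have := ler_wpM2l c10 hit_potential_step.
  have := ler_wpM2l c30 dead_potential_step; lra.
by exists v => //; apply: choices_ok.
Qed.

End Step.

Lemma embedding_seq (c1 c3 : R) (r : seq V) : 0 <= c1 -> 0 <= c3 ->
  forall (f : V -> V) (P : {set V}), partial_ok f P -> P \subset X -> uniq r ->
  {subset r <= X} -> (forall x, x \in r -> x \notin P) ->
  (forall r1 x r2, r = r1 ++ x :: r2 -> x \in Sp -> P :|: [set z in r1] \subset Sp) ->
  exists2 f', partial_ok f' (P :|: [set z in r]) &
    c1 * hit_potential f' (P :|: [set z in r]) +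
      c3 / 2 ^+ size r * dead_potential f' (P :|: [set z in r]) <=
    c1 * hit_potential f P + c3 * dead_potential f P.
Proof.
move=> c10; elim: r c3 => [|x r IHr] c3 c30 f P ok PX ur rX rP rSp.
  exists f; have -> : P :|: [set z in [::]] = P by apply/setP => z; rewrite !inE orbF.
    by [].
  by rewrite expr0 divr1.
have xX : x \in X by apply: rX; rewrite mem_head.
have xP : x \notin P by apply: rP; rewrite mem_head.
have PSp : x \in Sp -> P \subset Sp.
  move=> xSp; have := rSp [::] x r erefl xSp; apply: subset_trans.
  by apply/subsetP => z zP; rewrite inE zP.
have [v okv le] := embedding_step xX xP PX PSp ok c10 c30.
move: ur => /= /andP[xr ur].
have c30' : 0 <= c3 / 2 by rewrite divr_ge0.
have [||||f' ok' le'] := IHr (c3 / 2) c30' _ _ okv _ ur.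
- by rewrite subUset sub1set xX.
- by move=> z zr; apply: rX; rewrite inE zr orbT.
- move=> z zr; rewrite in_setU1 negb_or rP ?inE ?zr ?orbT // andbT.
  by apply: contraNneq xr => <-.
- move=> r1 z r2 e zSp; have := rSp (x :: r1) z r2; rewrite e => /(_ erefl zSp); apply: subset_trans.
  by apply/subsetP => u; rewrite !inE; case: (u == x); case: (u \in P).
have e : x |: P :|: [set z in r] = P :|: [set z in x :: r].
  by apply/setP => u; rewrite !inE; case: (u == x); case: (u \in P).
exists f'; rewrite -e //; apply: le_trans le; apply: le_trans le'.
by rewrite /= exprS invfM mulrA.
Qed.

Hypothesis many_good : forall w, (kst <= #|[set y in Ys | good w (s y)]|)%N.

Lemma embedding_exists : (0 < #|V|)%N ->
  exists f : V -> V, [/\ partial_ok f X,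
    forall w, (1 / 2) ^+ #|[set y in Ys | nb L y \subset [set x | G w (f x)]]| <=
      2 * (n * (1 - p ^+ D / 2) ^+ kst) :> R &
    forall T, B ^+ #|dead_set T f X| <= 2 * (2 ^+ #|V| * 2 ^+ #|X|)].
Proof.
move=> V0; have n0 : 0 < n by rewrite ltr0n.
pose K1 := n * (1 - p ^+ D / 2) ^+ kst.
have pD : p ^+ D <= 1 by apply: exprn_ile1.
have K10 : 0 < K1 by rewrite mulr_gt0 // exprn_gt0 //; lra.
have K30 : 0 < 2 ^+ #|V| :> R by apply: exprn_gt0.
have ok0 : partial_ok id set0.
  split=> [x|x|y _]; rewrite ?inE //.
  rewrite setI0 cards0 expr0 mul1r ler_nat; apply: subset_leq_card.
  apply/subsetP => v vb; rewrite inE vb /=; apply/forall_inP => z; by rewrite setI0 inE.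
have SpX : Sp \subset X.
  apply/subsetP => x /bigcupP[y yYs]; rewrite inE => /bipL.
  by rewrite (negPf (YsX yYs)); case: (x \in X).
(* The neighbours of special vertices come first, before other images can crowd their clusters. *)
pose r := enum Sp ++ enum (X :\: Sp).
have rE : [set z in r] = X.
  apply/setP => z; rewrite inE mem_cat !mem_enum inE.
  by case: (boolP (z \in Sp)) => [/(subsetP SpX)->|].
have ur : uniq r.
  rewrite cat_uniq !enum_uniq /= andbT; apply/hasPn => z /=.
  by rewrite !mem_enum inE => /andP[].
have sr : size r = #|X|.
  by rewrite size_cat -!cardE -(cardsID Sp X) (setIidPr SpX).
have rSp r1 x r2 : r = r1 ++ x :: r2 -> x \in Sp -> set0 :|: [set z in r1] \subset Sp.
  move=> e xSp; rewrite set0U; apply/subsetP => z; rewrite inE => zr1.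
  have xr1 : x \notin r1.
    by move: ur; rewrite e cat_uniq /= negb_or => /and3P[_ /andP[]].
  have sz : size r1 = index x (enum Sp).
    have : index x r = size r1 by rewrite e index_cat (negPf xr1) /= eqxx addn0.
    by rewrite /r index_cat mem_enum xSp.
  have lt : (size r1 < size (enum Sp))%N by rewrite sz index_mem mem_enum.
  have er1 : r1 = take (size r1) (enum Sp).
    by rewrite -[LHS](take_size_cat (x :: r2) erefl) -e /r take_cat lt.
  by move: zr1; rewrite er1 => /mem_take; rewrite mem_enum.
(* The coefficients normalise each initial potential to at most [1], so the final combination is at
   most [2]. *)
have [|||||f okf le] := @embedding_seq (1 / K1) (1 / 2 ^+ #|V|) r _ _ id set0 ok0 _ ur _ _ rSp.
- by rewrite divr_ge0 // ltW.
- by rewrite divr_ge0 // ltW.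
- exact: sub0set.
- by move=> z zr; rewrite -rE inE.
- by move=> z _; rewrite inE.
rewrite set0U rE sr in okf le.
have h1 : hit_potential id set0 <= K1.
  rewrite /hit_potential /K1 /n mulr_natl -sumr_const; apply: ler_sum => w _.
  have c01 : 0 <= 1 - p ^+ D / 2 <= 1.
    by have := exprn_ge0 D p0; lra.
  apply: (@le_trans _ _ ((1 - p ^+ D / 2) ^+ #|[set y in Ys | good w (s y)]|)); last first.
    by rewrite ler_wiXn2l //; case/andP: c01.
  rewrite -prodr_const big_mkcond [leRHS]big_mkcond /=; apply: ler_prod => y _.
  rewrite inE; case: (y \in Ys) => /=; last by rewrite ler01 lexx.
  rewrite hit_weight_ge0 /hit_weight /=; case: (good w (s y)) => //=.
  case: forall_inP => [_|[]]; last by move=> z; rewrite setI0 inE.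
  rewrite setD0; have : p ^+ D <= p ^+ #|nb L y| by rewrite ler_wiXn2l.
  lra.
have h3 : dead_potential id set0 <= 2 ^+ #|V|.
  rewrite /dead_potential; have -> : 2 ^+ #|V| = \sum_(T : {set V}) (1 : R).
    by rewrite sumr_const -natrX -cardsT -card_powerset powersetT cardsT.
  apply: ler_sum => T _; have -> : dead_set T id set0 = set0; last by rewrite cards0.
  apply/setP => y; rewrite in_set0 inE setI0 cards0 expr0 mul1r.
  have -> : cand (T :&: Uc (s y)) id set0 y = T :&: Uc (s y).
    apply/setP => v; rewrite inE andb_idr // => _.
    by apply/forall_inP => z; rewrite setI0 inE.
  by rewrite ltxx !andbF.
have {le}le2 : 1 / K1 * hit_potential f X + 1 / 2 ^+ #|V| / 2 ^+ #|X| * dead_potential f X <= 2.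
  apply: le_trans le _; rewrite -[leRHS]/(1 + 1); apply: lerD.
    by rewrite mul1r mulrC ler_pdivrMr // mul1r.
  by rewrite mul1r mulrC ler_pdivrMr // mul1r.
have B0 : 0 <= B by apply: le_trans B1.
have hp0 : 0 <= hit_potential f X.
  by apply: sumr_ge0 => w _; apply: prodr_ge0 => y _; apply: hit_weight_ge0.
have dp0 : 0 <= dead_potential f X.
  by apply: sumr_ge0 => T _; apply: exprn_ge0.
have K2 : 0 < 2 ^+ #|V| * 2 ^+ #|X| :> R by rewrite mulr_gt0 // exprn_gt0.
have hp : hit_potential f X <= 2 * K1.
  rewrite -ler_pdivrMr // mulrC -[X in X * _ <= _]mul1r; apply: le_trans le2.
  by rewrite lerDl !mulr_ge0 // ?invr_ge0 ltW // exprn_gt0.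
have dp : dead_potential f X <= 2 * (2 ^+ #|V| * 2 ^+ #|X|).
  rewrite -ler_pdivrMr //.
  have -> : dead_potential f X / (2 ^+ #|V| * 2 ^+ #|X|) = 1 / 2 ^+ #|V| / 2 ^+ #|X| * dead_potential f X.
    by rewrite invfM mul1r [RHS]mulrC.
  apply: le_trans le2.
  by rewrite lerDr !mulr_ge0 // ?invr_ge0 ltW.
exists f; split=> // [w|T].
- apply: le_trans hp; rewrite /hit_potential (bigD1 w) //= -[leLHS]addr0; apply: lerD; last first.
    by apply: sumr_ge0 => w' _; apply: prodr_ge0 => y _; apply: hit_weight_ge0.
  rewrite -prodr_const big_mkcond [leRHS]big_mkcond /=; apply: ler_prod => y _.
  rewrite inE; case: (boolP (y \in Ys)) => /= [yYs|_]; last by rewrite ler01 lexx.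
  have yX : nb L y \subset X.
    by apply/subsetP => x; rewrite inE => /bipL; rewrite (negPf (YsX yYs)); case: (x \in X).
  have -> : (nb L y \subset [set x | G w (f x)]) = [forall x in nb L y :&: X, G w (f x)].
    rewrite (setIidPl yX); apply/subsetP/forall_inP => h x xy; first by have := h x xy; rewrite inE.
    by rewrite inE h.
  rewrite /hit_weight; have -> : nb L y :\: X = set0 by apply/eqP; rewrite setD_eq0.
  rewrite cards0 expr0; case: [forall x in _, _]; rewrite ?andbF ?andbT; last by rewrite ler01 lexx.
  by case: (good _ _); lra.
- apply: le_trans dp; rewrite /dead_potential (bigD1 T) //= lerDl.
  by apply: sumr_ge0 => T' _; apply: exprn_ge0.
Qed.
End Embedding.

(** * Hall's condition *)

Definition fits (V : finType) (G L : rel V) (X : {set V}) (f : V -> V) : rel V :=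
  fun w y => (y \notin X) && [forall x in nb L y, G w (f x)].

(** Hall's theorem is applied from the leftover vertices of [G] towards [Y], because sets [T] of
    such vertices are what the dead sets control. Both sides have equal size, so the matching can be
    inverted. *)
Lemma copy_of_hall (V : finType) (G L : rel V) (X : {set V}) (f : V -> V) :
  symmetric G -> symmetric L -> (forall x y, L x y -> (x \in X) != (y \in X)) ->
  {in X &, injective f} ->
  (forall T : {set V}, T \subset ~: (f @: X) ->
     (#|T| <= #|\bigcup_(w in T) nb (fits G L X f) w|)%N) ->
  exists F : V -> V, injective F /\ forall u v, L u v -> G (F u) (F v).
Proof.
move=> symG symL bip finj /hall[g [ginj gfit]]; pose W := ~: (f @: X).
have gW : g @: W = ~: X.
  apply/eqP; rewrite eqEcard; apply/andP; split.
    by apply/subsetP => y /imsetP[w wW ->]; rewrite inE; have /andP[] := gfit w wW.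
  by rewrite card_in_imset // [#|W|]cardsCs setCK card_in_imset // cardsCs setCK.
(* The inverse of the matching; the default [y] is never taken outside [X]. *)
pose h y := odflt y [pick w in W | g w == y].
have hP y : y \notin X -> h y \in W /\ g (h y) = y.
  move=> yX; have : y \in g @: W by rewrite gW inE.
  case/imsetP=> w wW e; rewrite /h; case: pickP => [z /andP[zW /eqP]//|/(_ w)].
  by rewrite wW e eqxx.
pose F u := if u \in X then f u else h u.
have FX u : u \in X -> F u \in f @: X by move=> uX; rewrite /F uX imset_f.
have FY u : u \notin X -> F u \notin f @: X.
  by move=> uX; rewrite /F (negPf uX); have [] := hP u uX; rewrite inE.
have XY x y : x \in X -> y \notin X -> L y x -> G (F y) (F x).
  move=> xX yX Lyx; have [hW hg] := hP y yX; rewrite /F xX (negPf yX).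
  by have /andP[_ /forall_inP] := gfit _ hW; rewrite hg; apply; rewrite inE.
exists F; split=> [u v|u v Luv].
- case: (boolP (u \in X)) => uX; case: (boolP (v \in X)) => vX.
  + by rewrite /F uX vX; apply: finj.
  + by move=> e; have := FY v vX; rewrite -e FX.
  + by move=> e; have := FY u uX; rewrite e FX.
  + rewrite /F (negPf uX) (negPf vX) => e.
    by have [_ <-] := hP u uX; have [_ <-] := hP v vX; rewrite e.
- have := bip _ _ Luv; case: (boolP (u \in X)) => uX; case: (boolP (v \in X)) => vX // _.
    by rewrite symG; apply: XY => //; rewrite symL.
  exact: XY.
Qed.

Lemma cand_fits (V : finType) (G L : rel V) (X C : {set V}) f y w :
  symmetric G -> (forall x y, L x y -> (x \in X) != (y \in X)) -> y \notin X ->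
  w \in cand G L C f X y -> fits G L X f w y.
Proof.
move=> symG bip yX; rewrite inE => /andP[_ /forall_inP h]; rewrite /fits yX /=.
apply/forall_inP => x xy; rewrite symG; apply: h; rewrite inE xy /=.
by move: xy; rewrite inE => /bip; rewrite (negPf yX); case: (x \in X).
Qed.

(** The cases follow the size of [S I], the union of the clusters whose targets barely meet [T].
    Here [th] is the proportion of [Y], [e1] to [e5] are the errors paid by the margin [nu / 8], and
    [c] and [c6] are the densities that settle the two extreme cases. *)
Lemma hall_condition (R : realFieldType) (V : finType) (G L : rel V) (m : nat)
    (Vc Uc : 'I_m -> {set V}) (s : V -> 'I_m) (X Main : {set V}) (f : V -> V)
    (nu tau eta rho eps eps1 eps2 gam xi c c6 e1 e2 e3 e5 : R) :
  let n : R := #|V|%:R in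
  let th : R := #|~: X|%:R / n in
  let W := ~: (f @: X) in
  let S (I : {set 'I_m}) := \bigcup_(i in ~: I) Vc i in
  symmetric G -> (forall x y, L x y -> (x \in X) != (y \in X)) -> {in X &, injective f} ->
  cluster_system G rho eps eps1 gam Vc Uc -> #|~: \bigcup_i Vc i|%:R <= xi * n ->
  (forall v, eta * n <= #|nb G v|%:R) -> rexpander nu tau G -> (0 < #|V|)%N ->
  0 < nu -> nu <= tau -> tau <= eta / 2 -> eta < 1 -> 0 < rho -> rho <= 1 -> 0 < gam ->
  rho + eps2 <= nu ^+ 2 / 16 -> 2 * (rho + eps2) <= c * eta -> xi <= nu / 8 ->
  0 < eps2 -> 0 <= e1 -> 0 <= e2 -> 0 <= e3 -> 0 <= e5 -> e1 + e2 <= c6 ->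
  e1 + e2 + e3 + e5 + eps2 <= nu / 8 -> n <= 2 * #|~: X|%:R ->
  (forall y, y \in Main -> y \notin X) ->
  (forall w, c * n <= #|nb (fits G L X f) w|%:R) ->
  (forall y, y \notin X -> c6 * n <= #|[set w in W | fits G L X f w y]|%:R) ->
  (forall T, #|dead_set G L Uc s Main rho eps2 T f X|%:R <= e1 * n) ->
  #|~: X :\: Main|%:R <= e2 * n ->
  (forall i, (th - e3) * #|Vc i|%:R <= #|[set v in ~: X | s v == i]|%:R) ->
  (forall I, #|W :\: rnb nu G (S I)|%:R <= (n - #|rnb nu G (S I)|%:R) * th + e5 * n) ->
  (forall i, #|W :\: Uc i|%:R <= (n - #|Uc i|%:R) * th + e5 * n) ->
  forall T : {set V}, T \subset W -> (#|T| <= #|\bigcup_(w in T) nb (fits G L X f) w|)%N.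
Proof.
move=> n th W S symG bip finj sys cov mindeg expG V0 nu0 nutau taueta eta1 rho0 rho1 gam0.
move=> small1 small2 xinu eps20 e10 e20 e30 e50 e12 esum Ybig MX hits cands deads nonmain loads balP balU.
move=> T TW; rewrite -(ler_nat R).
have n0 : 0 < n by rewrite ltr0n.
have [disj sz nr _] := sys.
have M (u v : R) : u <= v -> u * n <= v * n by move=> h; rewrite ler_wpM2r // ltW.
have etanu : nu <= eta / 2 by move: nutau taueta; clear; lra.
have eta0 : 0 < eta by move: etanu nu0; clear; lra.
have nu1 : nu < 1 / 2 by move: etanu eta1; clear; lra.
have nun : 0 < nu * n by apply: mulr_gt0.
have nu2 : nu ^+ 2 <= nu / 2 by rewrite expr2 ler_pM2l //; move: nu1; clear; lra.
have thn : th * n = #|~: X|%:R by rewrite /th divfK // gt_eqF.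
have th1 : th <= 1 by rewrite ler_pdivrMr // mul1r ler_nat max_card.
have th12 : 1 / 2 <= th by rewrite ler_pdivlMr //; move: Ybig; rewrite -/n; clear; lra.
have th0 : 0 <= th by move: th12; clear; lra.
set N := \bigcup_(w in T) _.
(* For [i] in [I], almost all [y] assigned to cluster [i] are neighbours of [T], since a [y] in
   [Main] without a candidate in [T] is dead. *)
pose I := [set i | eps2 * n <= #|T :&: Uc i|%:R].
have deadP v : v \in Main -> s v \in I -> v \notin N -> v \in dead_set G L Uc s Main rho eps2 T f X.
  move=> vM; rewrite inE => big vN; rewrite inE vM big /=.
  rewrite [X in X < _](_ : _ = 0).
    rewrite mulr_gt0 ?exprn_gt0 //; apply: lt_le_trans big; exact: mulr_gt0.
  apply/eqP; rewrite pnatr_eq0 cards_eq0; apply/eqP/setP => w; rewrite in_set0.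
  apply: contraNF vN => wc; apply/bigcupP; exists w.
    by move: wc; rewrite inE => /andP[]; rewrite inE => /andP[].
  by rewrite inE; apply: cand_fits wc => //; apply: MX.
have N_lower : (th - e3) * (n - #|S I|%:R - xi * n) - (e1 + e2) * n <= #|N|%:R.
  pose YI := [set v in ~: X | s v \in I].
  have le1 : #|YI|%:R <= #|N|%:R + (e1 + e2) * n.
    have : (#|YI| <= #|N| + (#|~: X :\: Main| + #|dead_set G L Uc s Main rho eps2 T f X|))%N.
      apply: leq_trans (_ : #|N :|: ((~: X :\: Main) :|: dead_set G L Uc s Main rho eps2 T f X)| <= _)%N.
        apply: subset_leq_card; apply/subsetP => v; rewrite inE => /andP[vX vI].
        rewrite !in_setU in_setD vX andbT; case: (boolP (v \in N)) => //= vN.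
        by case: (boolP (v \in Main)) => //= vM; apply: deadP.
      apply: leq_trans (leq_card_setU _ _).1 _; rewrite leq_add2l.
      exact: (leq_card_setU _ _).1.
    by rewrite -(ler_nat R) !natrD; have := deads T; move: nonmain; clear; lra.
  have le2 : (th - e3) * \sum_(i in I) #|Vc i|%:R <= #|YI|%:R.
    have -> : #|YI| = (\sum_(i in I) #|[set v in ~: X | s v == i]|)%N.
      rewrite -sum1_card (partition_big s (mem I)) => [|v]; last by rewrite inE => /andP[].
      apply: eq_bigr => i iI; rewrite sum1_card; apply: eq_card => v.
      rewrite -[LHS]/((v \in YI) && (s v == i)).
      have -> : (v \in YI) = (v \in ~: X) && (s v \in I) by rewrite inE.
      by rewrite [in RHS]inE -andbA; congr (_ && _); apply: andb_idl => /eqP->.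
    by rewrite natr_sum mulr_sumr; apply: ler_sum.
  have le3 : n <= \sum_(i in I) #|Vc i|%:R + #|S I|%:R + xi * n.
    apply: le_trans (lerD (lexx _) cov).
    rewrite /S (card_bigcup_disjoint _ disj) natr_sum.
    have -> : \sum_(i in I) #|Vc i|%:R + \sum_(i in ~: I) #|Vc i|%:R = #|\bigcup_i Vc i|%:R :> R.
      rewrite (card_bigcup_disjoint _ disj) natr_sum [RHS](bigID (mem I)) /=; congr (_ + _).
      by apply: eq_bigl => i; rewrite inE.
    by rewrite -natrD /n -(cardsC (\bigcup_i Vc i)).
  have th3 : 0 <= th - e3 by move: th12 esum e10 e20 e50 eps20 nu1; clear; lra.
  have le4 : n - #|S I|%:R - xi * n <= \sum_(i in I) #|Vc i|%:R by move: le3; clear; lra.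
  by have := ler_wpM2l th3 le4; move: le1 le2; clear; lra.
have SIn : #|S I|%:R <= n by rewrite ler_nat max_card.
have SI0 : 0 <= #|S I|%:R :> R by rewrite ler0n.
have N_lower' : th * (n - #|S I|%:R) - th * (xi * n) - (e1 + e2 + e3) * n <= #|N|%:R.
  have xin : 0 <= xi * n by apply: le_trans cov; rewrite ler0n.
  apply: le_trans N_lower.
  have le : n - #|S I|%:R - xi * n <= n by move: SI0 xin; clear; lra.
  by have := ler_wpM2l e30 le; clear; lra.
have SItoT x : x \in S I -> #|nb G x :&: T|%:R <= (rho + eps2) * n.
  case/bigcupP=> i iI xi'.
  have small : #|Uc i :&: T|%:R < eps2 * n by move: iI; rewrite !inE -ltNge setIC.
  have := card_diffI (nb G x) (Uc i) T; rewrite -(ler_nat R) natrD; have := nr _ _ xi'.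
  by rewrite -/n; move: small; clear; lra.
have MainN : S I = set0 -> #|~: X|%:R - (e1 + e2) * n <= #|N|%:R.
  move=> SI; have allI i : i \in I.
    apply: contraT => iI; have [x xc] : exists x, x \in Vc i.
      apply/set0Pn; rewrite -card_gt0 -(ltr0n R); apply: lt_le_trans (sz i).
      exact: mulr_gt0.
    have xS : x \in S I by apply/bigcupP; exists i => //; rewrite in_setC.
    by move: xS; rewrite SI in_set0.
  have : (#|~: X| <= #|N| + (#|~: X :\: Main| + #|dead_set G L Uc s Main rho eps2 T f X|))%N.
    apply: leq_trans (_ : #|N :|: ((~: X :\: Main) :|: dead_set G L Uc s Main rho eps2 T f X)| <= _)%N.
      apply: subset_leq_card; apply/subsetP => v vX.
      rewrite !in_setU in_setD vX andbT; case: (boolP (v \in N)) => //= vN.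
      by case: (boolP (v \in Main)) => //= vM; apply: deadP.
    apply: leq_trans (leq_card_setU _ _).1 _; rewrite leq_add2l.
    exact: (leq_card_setU _ _).1.
  by rewrite -(ler_nat R) !natrD; have := deads T; move: nonmain; clear; lra.
(* With [S I] empty only [(e1 + e2) * n] vertices of [Y] can be missed. If some [y] is missed, its
   [c6 * n] candidates lie outside [T], which shrinks [T] by at least as much. *)
have [SI|[x0 x0S]] := set_0Vmem (S I).
  have cW : #|W|%:R = #|~: X|%:R :> R.
    by rewrite [#|W|]cardsCs setCK card_in_imset // [in RHS]cardsCs setCK.
  case: (boolP (~: X \subset N)) => [sub|/subsetPn[y yX yN]].
    by apply: le_trans (card_natr_le R sub); rewrite -cW card_natr_le.
  rewrite inE in yX.
  have : #|T|%:R + #|[set w in W | fits G L X f w y]|%:R <= #|W|%:R :> R.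
    rewrite -natrD ler_nat -(cardsID T W) (setIidPr TW) leq_add2l; apply: subset_leq_card.
    apply/subsetP => w; rewrite !inE => /andP[-> wf]; rewrite andbT.
    by apply: contra yN => wT; apply/bigcupP; exists w; rewrite ?inE.
  by have := cands y yX; have := MainN SI; have := M _ _ e12; rewrite cW; clear; lra.
have [/bigcupP[i0 i0I x0i]] := (x0S).
(* [S I] is too small to expand, but one target [Uc i0] with [i0] outside [I] is larger than it by a
   margin proportional to [eta] and is nearly avoided by [T]; it takes the role of the robust
   neighbourhood. *)
case: (ltP #|S I|%:R (tau * n)) => [ltS|geS].
  have := cluster_target_large sys gam0 mindeg V0 i0; rewrite -/n => largeU.
  have small : #|T :&: Uc i0|%:R < eps2 * n by move: i0I; rewrite !inE -ltNge.
  have leT : #|T|%:R <= #|T :&: Uc i0|%:R + #|W :\: Uc i0|%:R :> R.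
    rewrite -natrD ler_nat -(cardsID (Uc i0) T) leq_add2l subset_leq_card //.
    exact: setSD.
  have hU := balU i0.
  have h1 : (n - #|Uc i0|%:R) * th <= (1 - eta + rho) * n * th.
    by apply: ler_wpM2r => //; move: largeU; clear; lra.
  have h2 : th * (n - tau * n) <= th * (n - #|S I|%:R).
    by apply: ler_wpM2l => //; move: ltS; clear; lra.
  have gap : eta / 4 <= eta - tau - rho - xi.
    by move: taueta xinu etanu nu0 nu1 nu2 small1 eps20; clear; lra.
  have h3 : (1 / 2) * ((eta / 4) * n) <= th * ((eta - tau - rho - xi) * n).
    apply: ler_pM => //; [by rewrite divr_ge0 | by rewrite mulr_ge0 // ltW // divr_gt0 | exact: M].
  have := M _ _ esum; have := M _ _ etanu.
  by move: N_lower' hU leT small h1 h2 h3 nun; clear; lra.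
(* The expanding case: double counting shows that [T] nearly avoids [P], and balance turns the gain
   of [P] over [S I] into a gain of [N] over [T]. *)
case: (leP #|S I|%:R ((1 - tau) * n)) => [leS|gtS].
  have := expG _ geS leS; rewrite -/n; set P := rnb nu G (S I) => hP.
  have hTP : #|T :&: P|%:R <= (nu / 16) * n.
    have h : nu * n * #|T :&: P|%:R <= (rho + eps2) * n * #|S I|%:R.
      apply: (double_count symG) => [x xS|y].
        by apply: le_trans (SItoT x xS); rewrite card_natr_le // setIS // subsetIl.
      by rewrite inE => /andP[_]; rewrite inE.
    have h' : (rho + eps2) * n * #|S I|%:R <= nu * n * (nu / 16 * n).
      apply: (@le_trans _ _ ((nu ^+ 2 / 16) * n * n)); last by rewrite expr2; clear; lra.
      by apply: ler_pM => //; [rewrite mulr_ge0 ?addr_ge0 // ltW | apply: M].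
    by have := le_trans h h'; rewrite ler_pM2l // mulr_gt0.
  have leT : #|T|%:R <= #|T :&: P|%:R + #|W :\: P|%:R :> R.
    rewrite -natrD ler_nat -(cardsID P T) leq_add2l subset_leq_card //.
    exact: setSD.
  have hW := balP I; rewrite -/P in hW.
  have h1 : (n - #|P|%:R) * th <= (n - #|S I|%:R - nu * n) * th.
    by apply: ler_wpM2r => //; move: hP; clear; lra.
  have h2 : (1 / 2) * (7 / 8 * nu * n) <= th * ((nu - xi) * n).
    apply: ler_pM => //; [by rewrite divr_ge0 | by move: nun; clear; lra |].
    by apply: M; move: xinu; clear; lra.
  have := M _ _ esum; have := mulr_gt0 eps20 n0.
  by move: N_lower' hW leT hTP h1 h2 nun; clear; lra.
(* Now every vertex of [T] has [eta / 2 * n] neighbours in [S I], whose vertices see little of [T].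
   So [T] has at most [c * n] vertices, no more than a single [w0] can host. *)
have [->|[w0 w0T]] := set_0Vmem T; first by rewrite cards0 ler0n.
apply: (@le_trans _ _ (c * n)); last first.
  by apply: le_trans (hits w0) _; apply: card_natr_le; apply: (bigcup_sup w0).
have h : eta / 2 * n * #|T|%:R <= (rho + eps2) * n * #|S I|%:R.
  apply: (double_count symG) => [x xS|y yT]; first exact: SItoT.
  have := card_setI_lower R (nb G y) (S I); have := mindeg y; rewrite -/n.
  by have := M _ _ taueta; move: gtS; clear; lra.
have h' : (rho + eps2) * n * #|S I|%:R <= eta / 2 * n * (c * n).
  apply: (@le_trans _ _ ((c * eta / 2) * n * n)); last by clear; lra.
  apply: ler_pM => //; first by rewrite mulr_ge0 ?addr_ge0 // ltW.
  by apply: M; move: small2; clear; lra.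
have eta2 : 0 < eta / 2 * n by rewrite mulr_gt0 // divr_gt0.
by have := le_trans h h'; rewrite ler_pM2l.
Qed.

(** * Reservoirs, special vertices and constants *)

Lemma exists_reservoirs (R : realFieldType) (V J : finType) (F : J -> {set V}) (th r e : R) :
  0 <= th -> 0 <= r -> th + r <= 1 -> 0 <= e -> 2 * #|J|%:R <= e ^+ 2 * #|V|%:R ->
  exists VX VR : {set V}, [/\ [disjoint VX & VR],
    forall j, `| #|F j :&: VX|%:R - th * #|F j|%:R | <= e * #|V|%:R &
    forall j, `| #|F j :&: VR|%:R - r * #|F j|%:R | <= e * #|V|%:R].
Proof.
move=> th0 r0 thr e0 le; pose wt (c : 'I_3) : R := nth (1 - th - r) [:: th; r] c.
have wt0 c : 0 <= wt c by case: c => [[|[|[|//]]] hc]; rewrite /wt //=; lra.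
have wt1 : \sum_c wt c = 1 by rewrite !big_ord_recl big_ord0 /wt /=; lra.
have [ch H] := balanced_sets F wt0 wt1 e0 le.
pose c1 : 'I_3 := Ordinal (isT : (1 < 3)%N).
exists [set v | ch v == ord0], [set v | ch v == c1]; split=> [|j|j]; last 2 first.
- exact: H j ord0.
- exact: H j c1.
by rewrite -setI_eq0; apply/eqP/setP => v; rewrite !inE; case: eqP => // ->.
Qed.

(** Greedy choice: each chosen vertex forbids itself and at most [D * D] vertices sharing a
    neighbour with it. *)
Lemma exists_disjoint_nbs (V : finType) (L : rel V) (A : {set V}) (D k : nat) :
  symmetric L -> (forall v, (#|nb L v| <= D)%N) -> (k * (D * D + 1) <= #|A|)%N ->
  exists I : {set V}, [/\ I \subset A, #|I| = k &
    forall y y' x, y \in I -> y' \in I -> L y x -> L y' x -> y = y'].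
Proof.
move=> symL deg; elim: k => [_|k IHk le].
  by exists set0; split; rewrite ?sub0set ?cards0 // => y y' x; rewrite inE.
have [|I [sI cI disj]] := IHk; first by apply: leq_trans le; rewrite leq_mul2r leqnSn orbT.
have card_cup (B : {set V}) (H : V -> {set V}) d :
    (forall x, (#|H x| <= d)%N) -> (#|\bigcup_(x in B) H x| <= #|B| * d)%N.
  move=> h; rewrite -sum_nat_const; elim/big_ind2: _ => [|S j S' j' h1 h2|//]; first by rewrite cards0.
  by apply: leq_trans (leq_card_setU _ _).1 _; apply: leq_add.
pose N2 y := \bigcup_(x in nb L y) nb L x.
have N2D y : (#|N2 y| <= D * D)%N.
  by apply: leq_trans (card_cup _ _ D deg) _; rewrite leq_mul2r deg orbT.
have [y yA yn] : exists2 y, y \in A & y \notin I :|: \bigcup_(y in I) N2 y.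
  apply/subsetPn; apply/negP => /subset_leq_card; apply/negP; rewrite -ltnNge.
  apply: leq_ltn_trans (leq_card_setU _ _).1 _.
  apply: leq_trans le; rewrite cI mulSn mulnDr muln1.
  by have := card_cup I N2 (D * D)%N N2D; rewrite cI; lia.
move: yn; rewrite in_setU negb_or => /andP[yI yN].
exists (y |: I); split; first by rewrite subUset sub1set yA.
  by rewrite cardsU1 yI cI.
have new y' x : y' \in I -> L y x -> L y' x -> False.
  move=> y'I Lyx Ly'x; case/negP: yN; apply/bigcupP; exists y' => //.
  by apply/bigcupP; exists x; rewrite inE // symL.
move=> y1 y2 x; rewrite !in_setU1 => /orP[/eqP->|i1] /orP[/eqP->|i2] // l1 l2.
- by case: (new y2 x).
- by case: (new y1 x).
- exact: disj l1 l2.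
Qed.

Lemma pow2_gt_linear (u : nat) : (u ^ 2 <= 4 * 2 ^ u)%N.
Proof.
have h t : (t < 2 ^ t)%N by apply: ltn_expl.
have : ((u./2).+1 ^ 2 <= 2 ^ u)%N.
  apply: (@leq_trans ((2 ^ u./2) ^ 2)); first by rewrite leq_exp2r // h.
  by rewrite -expnM leq_exp2l // muln2 -[leqRHS]odd_double_half leq_addl.
have : (u <= 2 * (u./2).+1)%N by rewrite mul2n doubleS -[leqLHS]odd_double_half; case: (odd u); lia.
move=> h1 h2; apply: (@leq_trans ((2 * (u./2).+1) ^ 2)); first by rewrite leq_exp2r.
by rewrite expnMn leq_mul2l h2.
Qed.

Lemma exists_pow_le (R : archiRealFieldType) (lam del : R) : 0 <= lam < 1 -> 0 < del ->
  exists q : nat, lam ^+ q <= del.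
Proof.
move=> /andP[l0 l1] d0; have [->|lpos] := eqVneq lam 0; first by exists 1%N; rewrite expr1 ltW.
have {}lpos : 0 < lam by rewrite lt_def lpos.
pose x := lam^-1 - 1; have x0 : 0 < x by rewrite subr_gt0 invf_gt1.
have bern k : 1 + k%:R * x <= (lam^-1) ^+ k.
  elim: k => [|k IH]; first by rewrite mul0r addr0 expr0.
  rewrite exprS; apply: (@le_trans _ _ (lam^-1 * (1 + k%:R * x))); last first.
    by rewrite ler_wpM2l // invr_ge0.
  have -> : lam^-1 = 1 + x by rewrite /x; lra.
  rewrite -natr1; have : 0 <= k%:R * x * x by rewrite !mulr_ge0 // ltW.
  lra.
pose k := Num.bound (del^-1 / x); exists k.
have dx0 : 0 <= del^-1 / x by rewrite ltW // divr_gt0 ?invr_gt0.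
have := archi_boundP dx0; rewrite -/k ltr_pdivrMr // => lt.
rewrite -lef_pV2 ?posrE ?exprn_gt0 // -exprVn; apply: le_trans (bern k); lra.
Qed.

(** If [lam ^+ q <= 1 / 2], the hypothesis gives [h >= k / q - log (2 * n)] up to rounding, which is
    linear in [n]. The logarithm is avoided by [pow2_gt_linear]: a deficit [u] of order [n] would
    give [u ^ 2] at most [8 * n]. *)
Lemma exists_hit_constant (R : archiRealFieldType) (lam kap : R) : 0 <= lam < 1 -> 0 < kap ->
  exists c n0 : R, 0 < c /\ forall n : R, n0 <= n -> forall h k : nat, kap * n <= k%:R ->
    (1 / 2) ^+ h <= 2 * (n * lam ^+ k) -> c * n <= h%:R.
Proof.
move=> l01 k0; have /andP[l0 l1] := l01.
have [q0 q0le] := exists_pow_le l01 (ltac:(lra) : 0 < 1 / 2 :> R).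
pose q := q0.+1; have qle : lam ^+ q <= 1 / 2.
  by apply: le_trans q0le; rewrite ler_wiXn2l // ltW.
have qR : 0 < q%:R :> R by rewrite ltr0n.
pose c := kap / (4 * q%:R); have c0 : 0 < c by rewrite divr_gt0 // mulr_gt0.
exists c, (1 / c + 8 / c ^+ 2); split=> // n ngt h k kn le.
have c2 : 0 < c ^+ 2 by rewrite exprn_gt0.
have n0 : 0 < n by apply: lt_le_trans ngt; rewrite addr_gt0 // divr_gt0.
rewrite leNgt; apply/negP => lt.
pose j := (k %/ q)%N.
have lamk : lam ^+ k <= (1 / 2) ^+ j.
  apply: (@le_trans _ _ (lam ^+ (q * j))).
    by rewrite ler_wiXn2l ?(ltW l1) // mulnC leq_divM.
  by rewrite exprM; apply: lerXn2r => //; rewrite nnegrE ?exprn_ge0 //; lra.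
have cn1 : 1 <= c * n.
  by rewrite mulrC -ler_pdivrMr //; apply: le_trans ngt; rewrite lerDl ltW // divr_gt0.
have c8 : 8 <= n * c ^+ 2.
  by rewrite -ler_pdivrMr //; apply: le_trans ngt; rewrite lerDr ltW // divr_gt0.
have jn : c * n * 4 <= j%:R + 1.
  have : k%:R <= q%:R * (j%:R + 1) :> R.
    by rewrite natr1 -natrM ler_nat mulnC ltnW // ltn_ceil.
  have e4 : kap = c * (4 * q%:R) by rewrite /c divfK // gt_eqF // mulr_gt0.
  by rewrite e4 in kn => h1; rewrite -(ler_pM2l qR); lra.
have hj : (h <= j)%N by rewrite -(ler_nat R); lra.
pose u := (j - h)%N.
have up : 2 ^+ u <= 2 * n.
  have p2 i : 0 < (1 / 2 : R) ^+ i by apply: exprn_gt0; lra.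
  have : (1 / 2) ^+ h <= 2 * (n * (1 / 2) ^+ j).
    by apply: le_trans le _; rewrite ler_pM2l // ler_pM2l.
  have -> : j = (h + u)%N by rewrite subnKC.
  have -> : 2 * (n * (1 / 2) ^+ (h + u)) = (1 / 2) ^+ h * (2 * n * (1 / 2) ^+ u).
    by rewrite exprD; ring.
  rewrite -{1}[(1 / 2) ^+ h]mulr1 ler_pM2l // => h1.
  have P : 0 < 2 ^+ u :> R by apply: exprn_gt0.
  have h2 : (1 / 2) ^+ u * 2 ^+ u = 1 :> R.
    by rewrite -exprMn divfK ?expr1n // pnatr_eq0.
  have e : 2 * n * (1 / 2) ^+ u * 2 ^+ u = 2 * n by rewrite -[LHS]mulrA h2 mulr1.
  by have := ler_wpM2r (ltW P) h1; rewrite e mul1r.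
have un : 2 * (c * n) <= u%:R by rewrite /u natrB //; lra.
have := pow2_gt_linear u; rewrite -(ler_nat R) natrM !natrX => le4.
have h8 : 4 * (c * n) ^+ 2 <= 8 * n.
  apply: (@le_trans _ _ (u%:R ^+ 2)); last by apply: le_trans le4 _; lra.
  have -> : 4 * (c * n) ^+ 2 = (2 * (c * n)) ^+ 2 by ring.
  by apply: lerXn2r => //; rewrite nnegrE ?ler0n //; lra.
have : 4 * (n * c ^+ 2) <= 8 by rewrite -(ler_pM2r n0); move: h8; rewrite !expr2; lra.
lra.
Qed.

Lemma exists_floor (R : archiRealFieldType) (x : R) : 0 <= x ->
  exists k : nat, k%:R <= x < k%:R + 1.
Proof. by move/truncn_itv; rewrite -natr1 => h; eexists; exact: h. Qed.

Lemma card_set_type (T : finType) : #|{set T}| = (2 ^ #|T|)%N.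
Proof. by rewrite -[RHS](congr1 (expn 2) (cardsT T)) -card_powerset -cardsT; congr #|pred_of_set _|; apply/setP => A; rewrite !inE subsetT. Qed.

Lemma cluster_assignment (R : archiRealFieldType) (V : finType) (lab : V -> nat) (X : {set V})
    (m : nat) (Vc : 'I_m -> {set V}) (conn : rel 'I_m) (xi gam e4 sl : R) (ell b : nat) :
  let n : R := #|V|%:R in
  (forall i j, i != j -> [disjoint Vc i & Vc j]) -> (forall i, gam * n <= #|Vc i|%:R) ->
  #|~: \bigcup_i Vc i|%:R <= xi * n -> 0 <= xi <= 1 / 2 -> (0 < #|V|)%N ->
  (forall i j, connect conn i j) -> reflexive conn ->
  injective lab -> (forall v, (lab v < #|V|)%N) -> (0 < ell)%N -> (m + 2 <= b)%N ->
  0 <= e4 <= 1 -> 2 * (m + 3)%:R <= e4 * b%:R ->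
  2 * (b * ell)%:R <= e4 ^+ 2 * n -> 2 * e4 <= sl * gam -> 0 <= sl ->
  2 * #|X|%:R <= n ->
  exists (sg : nat -> 'I_m) (Tr : {set V}), let s v := sg (lab v %/ ell)%N in
  [/\ forall q, conn (sg q) (sg q.+1), #|Tr|%:R <= e4 * n,
    forall v w, v \notin Tr -> (lab v <= lab w + ell)%N -> (lab w <= lab v + ell)%N -> s w = s v,
    forall i, #|[set v in X | s v == i]|%:R <= (#|X|%:R / n + xi + sl) * #|Vc i|%:R &
    forall i, (#|~: X|%:R / n - sl) * #|Vc i|%:R <= #|[set v in ~: X | s v == i]|%:R].
Proof.
move=> n disj sz cov /andP[xi0 xi1] V0 connC connr labi labl ell0 bm /andP[e40 e41] hb hL hsl sl0 Xn.
have n0 : 0 < n by rewrite ltr0n.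
pose Sg : R := #|\bigcup_i Vc i|%:R.
have SgE : Sg = \sum_i #|Vc i|%:R by rewrite /Sg (card_bigcup_disjoint _ disj) natr_sum.
have Sgn : Sg <= n by rewrite ler_nat max_card.
have Sg_low : (1 - xi) * n <= Sg.
  by move: cov; rewrite -[n in X in X -> _]/n /n -(cardsC (\bigcup_i Vc i)) natrD -/Sg; lra.
have Sg0 : 0 < Sg by apply: lt_le_trans Sg_low; rewrite mulr_gt0 //; lra.
pose wt i : R := #|Vc i|%:R / Sg.
have wt0 i : 0 <= wt i by rewrite divr_ge0 // ltW.
have wt1 : \sum_i wt i = 1 by rewrite -mulr_suml -SgE divff // gt_eqF.
have b0 : (0 < b)%N by apply: leq_trans bm; rewrite addn2.
pose K := (#|V| %/ (b * ell)).+1.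
have bigK : (#|V| <= K * (b * ell))%N by rewrite ltnW // ltn_ceil // muln_gt0 b0.
have e0 : 0 <= e4 * n by rewrite mulr_ge0 // ltW.
have eL : 2 * (b * ell)%:R * #|V|%:R <= (e4 * n) ^+ 2.
  by rewrite exprMn [n ^+ 2]expr2 mulrA ler_wpM2r // ltW.
have [sg [Tr [h1 h2 h3 h4]]] := chunk_assignment (fun v => v \in X) labi labl connC connr wt0 wt1
  ell0 bm (ltn0Sn _ : 0 < K)%N bigK e0 eL.
have TrR : #|Tr|%:R <= e4 * n.
  apply: (@le_trans _ _ (K * (m + 3) * ell)%:R); first by rewrite ler_nat.
  have KR : K%:R * (b * ell)%:R <= n + (b * ell)%:R :> R.
    by rewrite -natrM -natrD ler_nat /K mulSn addnC leq_add2r leq_divM.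
  have h5 : 2 * (K * (m + 3) * ell)%:R <= e4 * (K%:R * (b * ell)%:R).
    have Q : 0 <= K%:R * ell%:R :> R by rewrite mulr_ge0.
    by have := ler_wpM2l Q hb; rewrite !natrM; lra.
  have h6 := ler_wpM2l e40 KR.
  have h7 : 2 * (b * ell)%:R <= n.
    by apply: le_trans hL _; apply: ler_piMl; [exact: ltW | exact: exprn_ile1].
  have h8 := ler_wpM2l e40 h7; have h9 : 0 <= e4 * n by [].
  by clear -h5 h6 h8 h9; lra.
(* The clusters cover only a share [1 - xi], so the load rises from [xn] to [xn / (1 - xi)]; this is
   at most [xn + xi] because [xn] and [xi] are at most [1 / 2]. *)
have wtX i : wt i * #|X|%:R <= (#|X|%:R / n + xi) * #|Vc i|%:R.
  rewrite /wt -[leLHS]mulrA [leLHS]mulrC ler_wpM2r // [leLHS]mulrC ler_pdivrMr //.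
  set xn := #|X|%:R / n; have xE : #|X|%:R = xn * n by rewrite /xn divfK // gt_eqF.
  have xn0 : 0 <= xn by rewrite divr_ge0 // ltW.
  have xn1 : xn <= 1 / 2 by rewrite ler_pdivrMr //; lra.
  rewrite [leLHS]xE; apply: le_trans (ler_wpM2l (addr_ge0 xn0 xi0) Sg_low).
  rewrite mulrA; apply: ler_wpM2r; first exact: ltW.
  by have := mulr_ge0 xi0 (ltac:(lra) : 0 <= 1 - xn - xi); lra.
have wtY i : #|~: X|%:R / n * #|Vc i|%:R <= wt i * #|~: X|%:R.
  rewrite /wt -[leRHS]mulrA [leRHS]mulrC ler_wpM2r // [leRHS]mulrC ler_wpM2l //.
  by rewrite lef_pV2 // posrE.
have small i : e4 * n + #|Tr|%:R <= sl * #|Vc i|%:R.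
  have := ler_wpM2l sl0 (sz i); have := ler_wpM2r (ltW n0) hsl; lra.
exists sg, Tr; split=> // i.
  have := h4 true i; rewrite ler_norml => /andP[_].
  have -> : [set v | (v \in X) == true] = X by apply/setP => v; rewrite inE eqb_id.
  have -> : [set v | (v \in X == true) && (sg (lab v %/ ell)%N == i)] =
    [set v in X | sg (lab v %/ ell)%N == i] by apply/setP => v; rewrite !inE eqb_id.
  by have := small i; have := wtX i; lra.
have := h4 false i; rewrite ler_norml => /andP[+ _].
have -> : [set v | (v \in X) == false] = ~: X by apply/setP => v; rewrite !inE eqbF_neg.
have -> : [set v | (v \in X == false) && (sg (lab v %/ ell)%N == i)] =
  [set v in ~: X | sg (lab v %/ ell)%N == i] by apply/setP => v; rewrite !inE eqbF_neg.
by have := small i; have := wtY i; lra.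
Qed.

(** The neighbours of [y] have labels in a window of length [ell], hence in two consecutive
    intervals. This is why only targets of linked clusters must overlap. *)
Lemma card_base (V : finType) (L : rel V) (lab : V -> nat) (m : nat) (Uc : 'I_m -> {set V})
    (sg : nat -> 'I_m) (VR : {set V}) (ell : nat) (y : V) :
  (0 < ell)%N -> (forall x x', L y x -> L y x' -> (lab x <= lab x' + ell)%N) ->
  exists q, (#|(Uc (sg q) :&: Uc (sg q.+1)) :&: VR| <=
    #|VR :&: \bigcap_(x in nb L y) Uc (sg (lab x %/ ell)%N)|)%N.
Proof.
move=> ell0 close; have [y0|[x0 x0y]] := set_0Vmem (nb L y).
  exists 0%N; rewrite y0 big_set0 setIT; exact: subset_leq_card (subsetIr _ _).
have [x1 x1y xmin] := arg_minnP lab x0y.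
exists (lab x1 %/ ell)%N; apply: subset_leq_card; apply/subsetP => v.
rewrite !inE => /andP[/andP[v1 v2] ->] /=; apply/bigcapP => x xy.
have le1 : (lab x1 %/ ell <= lab x %/ ell)%N by rewrite leq_div2r // xmin.
have le2 : (lab x %/ ell <= (lab x1 %/ ell).+1)%N.
  rewrite -divnD1 // leq_div2r // close //; first by move: xy; rewrite inE.
  by have x1N : x1 \in nb L y := x1y; move: x1N; rewrite inE.
have [->//|ne] := eqVneq (lab x %/ ell)%N (lab x1 %/ ell)%N.
by have -> : (lab x %/ ell = (lab x1 %/ ell).+1)%N by lia.
Qed.

Section Special.
Variables (V : finType) (L : rel V) (m : nat) (s : V -> 'I_m) (Main : {set V}) (D : nat).
Hypotheses (symL : symmetric L) (degL : forall v, (#|nb L v| <= D)%N).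
Hypothesis mainP : forall y x, y \in Main -> L y x -> s x = s y.

(** Special vertices are chosen cluster by cluster; those of different clusters share no neighbour
    because the neighbours of a vertex of [Main] lie in its own cluster. *)
Lemma exists_special (k : 'I_m -> nat) :
  (forall i, (k i * (D * D + 1) <= #|[set y in Main | s y == i]|)%N) ->
  exists Ys : {set V}, [/\ Ys \subset Main, forall i, #|[set y in Ys | s y == i]| = k i &
    forall y y' x, y \in Ys -> y' \in Ys -> L y x -> L y' x -> y = y'].
Proof.
move=> le; have [I HI] := fin_all_exists (fun i => exists_disjoint_nbs symL degL (le i)).
have IM i y : y \in I i -> y \in Main /\ s y = i.
  by have [sI _ _] := HI i; move=> /(subsetP sI); rewrite inE => /andP[? /eqP].
exists (\bigcup_i I i); split=> [|i|y y' x].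
- by apply/bigcupsP => i _; apply/subsetP => y /IM[].
- have [_ <- _] := HI i; apply: eq_card => y; rewrite inE.
  apply/andP/idP => [[/bigcupP[j _ yj] /eqP e]|yi].
    by have [_ ej] := IM j y yj; rewrite -e ej.
  by have [_ ->] := IM i y yi; rewrite eqxx; split=> //; apply/bigcupP; exists i.
- case/bigcupP=> i _ yi /bigcupP[j _ yj] l1 l2.
  have [yM ei] := IM i y yi; have [yM' ej] := IM j y' yj.
  have e : i = j by rewrite -ei -ej -(mainP yM l1) -(mainP yM' l2).
  have [_ _ disj] := HI i; apply: disj l1 l2 => //; by rewrite e.
Qed.

Variables (Ys : {set V}).
Hypothesis sYs : Ys \subset Main.

Lemma card_special_nbs (i : 'I_m) :
  (#|[set x in \bigcup_(y in Ys) nb L y | s x == i]| <= #|[set y in Ys | s y == i]| * D)%N.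
Proof.
apply: (@leq_trans #|\bigcup_(y in [set y in Ys | s y == i]) nb L y|).
  apply: subset_leq_card; apply/subsetP => x; rewrite inE => /andP[/bigcupP[y yY xy] /eqP e].
  apply/bigcupP; exists y => //; rewrite inE yY -e (mainP (subsetP sYs y yY)) ?eqxx //.
  by move: xy; rewrite inE.
rewrite -sum_nat_const; elim/big_ind2: _ => [|S j S' j' h1 h2|y _ //]; first by rewrite cards0.
by apply: leq_trans (leq_card_setU _ _).1 _; apply: leq_add.
Qed.

Lemma card_by_cluster (A : {set V}) (P : pred 'I_m) :
  #|[set y in A | P (s y)]| = (\sum_(i | P i) #|[set y in A | s y == i]|)%N.
Proof.
rewrite -sum1_card (partition_big s P) => [|y]; last by rewrite inE => /andP[].
apply: eq_bigr => i Pi; rewrite sum1_card; apply: eq_card => y.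
rewrite -[LHS]/((y \in [set y in A | P (s y)]) && (s y == i)) !inE -andbA.
by congr (_ && _); apply: andb_idl => /eqP->.
Qed.

End Special.

(** At most [#|P :&: VX| + #|Sp|] images fall into [P]. As [VX] has hardly more than its share
    [#|X| / n] of [P], the remaining images must fall outside [P] and leave little free room
    there. *)
Lemma leftover_balanced (R : realFieldType) (V : finType) (X P VX Sp : {set V}) (f : V -> V)
    (dl e sp : R) :
  let n : R := #|V|%:R in
  (0 < #|V|)%N -> {in X &, injective f} -> (forall x, x \in X -> x \notin Sp -> f x \in VX) ->
  #|P :&: VX|%:R <= (#|X|%:R / n + dl) * #|P|%:R + e * n -> #|Sp|%:R <= sp * n -> 0 <= dl ->
  #|~: (f @: X) :\: P|%:R <= (n - #|P|%:R) * (#|~: X|%:R / n) + (dl + e + sp) * n.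
Proof.
move=> n V0 finj fVX hP hSp dl0; have n0 : 0 < n by rewrite ltr0n.
have cX : n = #|X|%:R + #|~: X|%:R by rewrite -natrD cardsC.
have h1 : #|f @: X :&: P|%:R <= #|P :&: VX|%:R + #|Sp|%:R :> R.
  rewrite -natrD ler_nat; apply: (@leq_trans #|P :&: VX :|: f @: Sp|).
    apply: subset_leq_card; apply/subsetP => v; rewrite inE => /andP[/imsetP[x xX ->] fP].
    rewrite in_setU inE fP /=; case: (boolP (x \in Sp)) => [xSp|/(fVX x xX)->//].
    by rewrite imset_f ?orbT.
  by apply: leq_trans (leq_card_setU _ _).1 _; rewrite leq_add2l leq_imset_card.
have h2 : #|~: (f @: X) :\: P|%:R = n - #|P|%:R - (#|X|%:R - #|f @: X :&: P|%:R) :> R.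
  have e1 := cardsCs (~: (f @: X) :\: P); have e2 := cardsUI (f @: X) P.
  rewrite setCD setCK in e1; rewrite (card_in_imset finj) in e2.
  have e3 : #|~: (f @: X) :\: P|%:R = n - #|f @: X :|: P|%:R :> R.
    by rewrite e1 natrB // max_card.
  have /(congr1 (fun k => k%:R : R)) := e2; rewrite !natrD e3; lra.
have Pn : #|P|%:R <= n by rewrite ler_nat max_card.
have dlP := ler_wpM2l dl0 Pn.
have thE : #|~: X|%:R / n = 1 - #|X|%:R / n.
  by rewrite -[X in X - _](divff (lt0r_neq0 n0)) -mulrBl [X in X - _]cX [X in X - _]addrC addrK.
rewrite thE h2; clearbody n; have xE : #|X|%:R = #|X|%:R / n * n by rewrite divfK // gt_eqF.
rewrite [in X in _ <= X]mulrBr; lra.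
Qed.

Lemma card_good_clusters (R : realFieldType) (V : finType) (G : rel V) (m : nat) (Vc : 'I_m -> {set V})
    (eta xi : R) (w : V) :
  (forall i j, i != j -> [disjoint Vc i & Vc j]) -> #|~: \bigcup_i Vc i|%:R <= xi * #|V|%:R ->
  0 <= eta -> eta * #|V|%:R <= #|nb G w|%:R ->
  (eta / 2 - xi) * #|V|%:R <= \sum_(i | good G Vc (eta / 2) w i) #|Vc i|%:R.
Proof.
move=> disj cov eta0 deg.
have h1 : #|nb G w|%:R <= #|\bigcup_i (nb G w :&: Vc i)|%:R + #|~: \bigcup_i Vc i|%:R :> R.
  rewrite -natrD ler_nat; apply: leq_trans (leq_card_setU _ _).1; apply: subset_leq_card.
  apply/subsetP => v vw; rewrite in_setU; case: (boolP (v \in \bigcup_i Vc i)) => [/bigcupP[i _ vi]|nv].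
    by apply/orP; left; apply/bigcupP; exists i => //; rewrite in_setI vw.
  by rewrite in_setC nv orbT.
have h2 : #|\bigcup_i (nb G w :&: Vc i)|%:R = \sum_i #|nb G w :&: Vc i|%:R :> R.
  rewrite card_bigcup_disjoint ?natr_sum // => i j ij.
  by apply: disjointWl (subsetIr _ _) _; apply: disjointWr (subsetIr _ _) _; apply: disj.
have h3 : \sum_i #|Vc i|%:R <= #|V|%:R :> R.
  by rewrite -natr_sum -(card_bigcup_disjoint xpredT disj) ler_nat max_card.
have h4 : \sum_i #|nb G w :&: Vc i|%:R <=
    \sum_(i | good G Vc (eta / 2) w i) #|Vc i|%:R + eta / 2 * \sum_i #|Vc i|%:R.
  rewrite mulr_sumr [X in _ <= X + _]big_mkcond -big_split /=; apply: ler_sum => i _.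
  have sub : #|nb G w :&: Vc i|%:R <= #|Vc i|%:R :> R by apply: card_natr_le; exact: subsetIr.
  have := mulr_ge0 eta0 (ler0n R #|Vc i|); rewrite /good.
  by case: (leP (eta / 2 * #|Vc i|%:R) #|nb G w :&: Vc i|%:R) => h /=; lra.
have := ler_wpM2l eta0 h3; lra.
Qed.

(** The base [8 = 2 ^ 3] pays for three factors [2 ^ n]: the sets [T], the doublings, and the
    initial constant [2]. *)
Lemma dead_bound (R : realFieldType) (q d n x : nat) : (x <= n)%N -> (0 < n)%N ->
  ((8 : R) ^+ q) ^+ d <= 2 * (2 ^+ n * 2 ^+ x) -> (q * d <= n)%N.
Proof.
move=> xn n0; rewrite -exprM -!natrX -!natrM ler_nat => le.
rewrite -(@leq_exp2l 8) //; apply: leq_trans le _.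
by rewrite -expnD -expnS -[8%N]/(2 ^ 3)%N -expnM leq_exp2l //; lia.
Qed.

(** * Assembling the embedding for given constants *)

Lemma copy_exists (R : archiRealFieldType) (V : finType) (G L : rel V) (X : {set V})
    (lab : V -> nat) (D : nat) (nu tau eta c rho eps eps1 e4 err sigma xi gam : R)
    (k M q b ell kst : nat) :
  let n : R := #|V|%:R in let c7 := eta * nu ^+ 2 / 128 in
  symmetric G -> symmetric L -> (forall x y, L x y -> (x \in X) != (y \in X)) ->
  (forall v, (#|nb L v| <= D)%N) -> injective lab -> (forall v, (lab v < #|V|)%N) ->
  (forall y x x', L y x -> L y x' -> (lab x <= lab x' + ell)%N) ->
  (forall x y, L x y -> (lab x <= lab y + ell)%N) ->
  (forall v, eta * n <= #|nb G v|%:R) -> rexpander nu tau G -> (0 < #|V|)%N ->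
  2 * #|X|%:R <= n ->
  0 < nu -> nu <= tau -> tau <= eta / 2 -> eta < 1 -> 0 < c ->
  0 < rho -> rho <= nu ^+ 2 / 32 -> 4 * rho <= c * eta ->
  0 < sigma -> sigma * D%:R <= nu / 128 -> sigma * (D * D + 1)%:R <= nu / 128 ->
  (0 < q)%N -> q%:R^-1 <= rho ^+ D * c7 / 2 -> q%:R^-1 <= nu / 64 ->
  0 < eps1 -> eps1 <= rho ^+ D * rho -> eps1 <= rho ^+ D * c7 ->
  0 < eps <= 1 -> D%:R * eps * (8 ^+ q) ^+ D <= nu / 512 ->
  1 <= k%:R * eps1 -> 0 < xi -> xi <= nu / 1024 -> gam = eps ^+ k * xi -> 1 < M%:R * gam ->
  0 < e4 <= 1 -> e4 <= rho ^+ D * c7 / 2 -> 2 * e4 <= nu / 1024 * gam -> e4 <= nu / 1024 ->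
  (M + 2 <= b)%N -> 2 * (M + 3)%:R <= e4 * b%:R ->
  0 <= err -> err <= eta / 16 * gam -> err <= c7 -> err <= nu / 1024 * gam -> err <= nu / 1024 ->
  2 * (M + 2 ^ M + M * M)%:R <= err ^+ 2 * n -> (0 < ell)%N ->
  2 * (b * ell)%:R <= e4 ^+ 2 * n -> kst%:R + M%:R <= sigma * (eta / 4) * n ->
  (forall h : nat, (1 / 2) ^+ h <= 2 * (n * (1 - (eta / 8) ^+ D / 2) ^+ kst) -> c * n <= h%:R) ->
  exists F : V -> V, injective F /\ forall u v, L u v -> G (F u) (F v).
Proof.
move=> n c7 symG symL bip degL labi labl close near mindeg expG V0 Xn.
move=> nu0 nutau taueta eta1 c0 rho0 rhonu rhoc sg0 sgD sgD2 q0 q1 q2.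
move=> e10 e1a e1b ep epsB kk xi0 xinu gamE MM /andP[e40 e41] e4c e4g e4nu bM b2.
move=> err0 err1 err2 err3 err4 nJ ell0 nL nk nh.
have /andP[eps0 epsle] := ep.
have n0 : 0 < n by rewrite ltr0n.
have etanu : nu <= eta / 2 by move: nutau taueta; clear; lra.
have eta0 : 0 < eta by move: nu0 etanu; clear; lra.
have nu1 : nu < 1 / 2 by move: etanu eta1; clear; lra.
have nu2 : nu ^+ 2 <= nu / 2 by rewrite expr2 ler_pM2l //; move: nu1; clear; lra.
have nu20 : 0 < nu ^+ 2 by rewrite exprn_gt0.
have rho1 : rho <= 1 by move: rhonu nu2 nu1; clear; lra.
have rhonu4 : rho <= nu ^+ 2 / 4 by move: rhonu nu20; clear; lra.
have xinu2 : xi <= nu / 2 by move: xinu nu0; clear; lra.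
have gam0 : 0 < gam by rewrite gamE mulr_gt0 // exprn_gt0.
have c70 : 0 < c7 by rewrite divr_gt0 // mulr_gt0.
have rD0 : 0 < rho ^+ D by rewrite exprn_gt0.
have MM' : 1 < M%:R * (eps ^+ k * xi) by rewrite -gamE.
have [m [Vc [Uc [mM sys cov]]]] := exists_clusters G (ltW rho0) ep e10 xi0 kk MM' V0.
rewrite -gamE in sys.
have [disj sz nr _] := sys.
pose conn := fun i j : 'I_m => nu ^+ 2 / 4 * n <= #|Uc i :&: Uc j|%:R.
have connC i j : connect conn i j.
  by apply: (cluster_connected symG sys nu0 nutau taueta eta1 (ltW rho0) rhonu4 xinu2 gam0 cov mindeg expG V0).
have connr : reflexive conn.
  move=> i; rewrite /conn setIid; apply: le_trans (cluster_target_large sys gam0 mindeg V0 i).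
  by apply: ler_wpM2r; [exact: ltW | move: nu2 rhonu etanu nu0; clear; lra].
have sl0 : 0 <= nu / 1024 by move: nu0; clear; lra.
have xi01 : 0 <= xi <= 1 / 2 by move: xi0 xinu nu1; clear; lra.
have mb : (m + 2 <= b)%N by apply: leq_trans bM; rewrite leq_add2r.
have e401 : 0 <= e4 <= 1 by rewrite (ltW e40).
have mb2 : 2 * (m + 3)%:R <= e4 * b%:R.
  by apply: le_trans b2; rewrite ler_pM2l // ler_nat leq_add2r.
have [sg [Tr [hconn TrS Trs loadX loadY]]] := cluster_assignment
  disj sz cov xi01 V0 connC connr labi labl ell0 mb e401 mb2 nL e4g sl0 Xn.
pose s v := sg (lab v %/ ell)%N.
rewrite -/n in TrS loadX loadY.
set xn := #|X|%:R / n in loadX; set th := #|~: X|%:R / n in loadY.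
have xE : #|X|%:R = xn * n by rewrite /xn divfK // gt_eqF.
have thE : #|~: X|%:R = th * n by rewrite /th divfK // gt_eqF.
have xth : xn + th = 1.
  by apply: (mulIf (lt0r_neq0 n0)); rewrite mulrDl -xE -thE mul1r -natrD cardsC.
have xn0 : 0 <= xn by rewrite divr_ge0 // ltW.
have xn1 : xn <= 1 / 2 by rewrite ler_pdivrMr //; move: Xn; clear; lra.
have v0 i : 0 < #|Vc i|%:R :> R by apply: lt_le_trans (sz i); rewrite mulr_gt0.
have perturb (e t : R) i : 0 <= t -> e <= t * gam -> e * n <= t * #|Vc i|%:R.
  move=> t0 le; apply: (@le_trans _ _ (t * (gam * n))); last by rewrite ler_wpM2l.
  by rewrite mulrA ler_wpM2r // ltW.
pose Main := [set y | (y \notin X) && [forall x in nb L y, s x == s y]].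
have MX y : y \in Main -> y \notin X by rewrite inE => /andP[].
have mainP y x : y \in Main -> L y x -> s x = s y.
  by rewrite inE => /andP[_ /forall_inP h] Lyx; apply/eqP/h; rewrite inE.
have nonmain : #|~: X :\: Main|%:R <= e4 * n.
  apply: le_trans TrS; apply: card_natr_le; apply/subsetP => y; rewrite inE => /andP[yM yX].
  apply: contraR yM => yT; rewrite inE in yX; rewrite inE yX /=; apply/forall_inP => x.
  rewrite inE => Lyx; apply/eqP; apply: Trs => //; first exact: near.
  by apply: near; rewrite symL.
(* The surplus [nu / 64] makes [VX] exceed the load of [X] in every cluster, yet is small enough to
   be paid by the expansion margin. *)
pose th0 := xn + nu / 64.
(* The clusters give room for [X], the robust neighbourhoods serve the expanding case of Hall's
   condition, and the pairs serve the candidates in [VR] as well as, on the diagonal, the single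
   targets. *)
pose FJ (j : 'I_m + {set 'I_m} + 'I_m * 'I_m) : {set V} := match j with
  | inl (inl i) => Vc i
  | inl (inr Q) => rnb nu G (\bigcup_(i in ~: Q) Vc i)
  | inr (i, j) => Uc i :&: Uc j end.
have [|||||VX [VR [disjVR HX HR]]] := @exists_reservoirs R V _ FJ th0 (eta / 16) err.
- by rewrite /th0; move: xn0 nu0; clear; lra.
- by move: eta0; clear; lra.
- by rewrite /th0; move: xn1 nu1 eta1; clear; lra.
- exact: err0.
- apply: le_trans nJ; rewrite ler_pM2l // ler_nat !card_sum card_prod card_set_type !card_ord.
  by rewrite leq_add ?leq_add ?leq_exp2l ?leq_mul.
have VXi i : (th0 - nu / 1024) * #|Vc i|%:R <= #|Vc i :&: VX|%:R.
  have := HX (inl (inl i)); rewrite ler_norml /= => /andP[h _].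
  by have := perturb err (nu / 1024) i sl0 err3; move: h; rewrite -/n; clear; lra.
have eta16 : 0 <= eta / 16 by move: eta0; clear; lra.
have VRi i : #|VR :&: Vc i|%:R <= eta / 8 * #|Vc i|%:R.
  have := HR (inl (inl i)); rewrite ler_norml /= setIC => /andP[_ h].
  by have := perturb err (eta / 16) i eta16 err1; move: h; rewrite -/n; clear; lra.
have VRc i j : conn i j -> c7 * n <= #|Uc i :&: Uc j :&: VR|%:R.
  move=> cij; have := HR (inr (i, j)); rewrite ler_norml /= -/n => /andP[h _].
  have := ler_wpM2l eta16 cij; have := ler_wpM2r (ltW n0) err2.
  by move: h; rewrite /c7; clear; lra.
have base_large y : c7 * n <= #|VR :&: \bigcap_(x in nb L y) Uc (s x)|%:R.
  have [p hp] := card_base Uc sg VR ell0 (close y).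
  by apply: le_trans (VRc _ _ (hconn p)) _; rewrite ler_nat.
have main_i i : 1 / 4 * #|Vc i|%:R <= #|[set y in Main | s y == i]|%:R :> R.
  have h : #|[set v in ~: X | s v == i]|%:R <= #|[set y in Main | s y == i]|%:R + #|~: X :\: Main|%:R :> R.
    rewrite -natrD ler_nat; apply: leq_trans (leq_card_setU _ _).1; apply: subset_leq_card.
    apply/subsetP => y; rewrite in_setU in_setD !in_set => /andP[-> ->].
    by rewrite !andbT; case: (_ && _).
  have := perturb (2 * e4) (nu / 1024) i sl0 e4g; have := loadY i; rewrite -/(s _).
  have hth : 1 / 4 + nu / 1024 <= th - nu / 1024 by move: xth xn1 nu1; clear; lra.
  have := ler_wpM2r (ltW (v0 i)) hth; have := mulr_ge0 (ltW e40) (ltW n0).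
  by move: h nonmain; clear; lra.
have [kf kfP] := fin_all_exists (fun i => exists_floor (ltW (mulr_gt0 sg0 (v0 i)))).
have kfD i (z : nat) : sigma * z%:R <= nu / 128 -> (kf i * z)%:R <= nu / 128 * #|Vc i|%:R.
  move=> le; have /andP[h _] := kfP i; rewrite natrM.
  apply: (@le_trans _ _ (sigma * #|Vc i|%:R * z%:R)); first by rewrite ler_wpM2r.
  by rewrite mulrAC ler_wpM2r // ltW.
have kf_le i : (kf i * (D * D + 1) <= #|[set y in Main | s y == i]|)%N.
  rewrite -(ler_nat R); apply: le_trans (kfD i _ sgD2) _; apply: le_trans (main_i i).
  by apply: ler_wpM2r; [exact: ltW | move: nu1; clear; lra].
have [Ys [sYs cYs disjYs]] := exists_special symL degL mainP kf_le.
pose Sp := \bigcup_(y in Ys) nb L y.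
have Sp_i i : #|[set x in Sp | s x == i]|%:R <= nu / 128 * #|Vc i|%:R.
  apply: le_trans (kfD i D sgD); rewrite ler_nat -cYs.
  by apply: (card_special_nbs (Main := Main)).
have sumV : \sum_i #|Vc i|%:R <= n.
  by rewrite -natr_sum -(card_bigcup_disjoint xpredT disj) ler_nat max_card.
have cSp : #|Sp|%:R <= nu / 128 * n.
  have -> : #|Sp| = (\sum_i #|[set x in Sp | s x == i]|)%N.
    by rewrite -(card_by_cluster s Sp xpredT); apply: eq_card => v; rewrite [RHS]inE /= andbT.
  rewrite natr_sum; apply: le_trans (ler_sum _ (fun i _ => Sp_i i)) _.
  by rewrite -mulr_sumr; apply: ler_wpM2l => //; move: nu0; clear; lra.
have B1 : 1 <= (8 : R) ^+ q by rewrite -natrX ler1n expn_gt0.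
have epsD : D%:R * eps <= nu / 512.
  by apply: le_trans epsB; rewrite ler_peMr ?mulr_ge0 ?(ltW eps0) // exprn_ege1.
have epsDi i : D%:R * (eps * #|Vc i|%:R) <= nu / 512 * #|Vc i|%:R.
  by rewrite mulrA ler_wpM2r // ltW.
have nuV i : nu * #|Vc i|%:R <= eta / 2 * #|Vc i|%:R by apply: ler_wpM2r; [exact: ltW | exact: etanu].
have av1 i : #|[set x in Sp | s x == i]|%:R + #|VR :&: Vc i|%:R + D%:R * (eps * #|Vc i|%:R) +
    eta / 8 * #|Vc i|%:R <= eta / 2 * #|Vc i|%:R.
  by have := Sp_i i; have := VRi i; have := epsDi i; have := nuV i; have := v0 i; have := mulr_gt0 eta0 (v0 i); clear; lra.
have av2 i : #|[set x in X | s x == i]|%:R + D%:R * (eps * #|Vc i|%:R) + nu / 512 * #|Vc i|%:R <=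
    #|Vc i :&: VX|%:R.
  have := loadX i; rewrite -/(s _) => h1; have h2 := VXi i; have h3 := epsDi i.
  have h4 := ler_wpM2r (ltW (v0 i)) xinu; have h5 := mulr_gt0 nu0 (v0 i).
  by move: h1 h2 h3 h4 h5; rewrite /th0; clear; lra.
have good_many w : (kst <= #|[set y in Ys | good G Vc (eta / 2) w (s y)]|)%N.
  rewrite (card_by_cluster s Ys (good G Vc (eta / 2) w)) -(ler_nat R) natr_sum.
  have h1 := card_good_clusters disj cov (ltW eta0) (mindeg w).
  have h2 : \sum_(i | good G Vc (eta / 2) w i) (sigma * #|Vc i|%:R - 1) <=
      \sum_(i | good G Vc (eta / 2) w i) #|[set y in Ys | s y == i]|%:R.
    by apply: ler_sum => i _; rewrite cYs; have /andP[_ h] := kfP i; move: h; clear; lra.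
  have h3 : \sum_(i | good G Vc (eta / 2) w i) (1 : R) <= M%:R.
    by rewrite sumr_const ler_nat (leq_trans _ mM) // -[leqRHS]card_ord max_card.
  rewrite sumrB -mulr_sumr in h2.
  have h4 : eta / 4 * n <= (eta / 2 - xi) * n.
    by apply: ler_wpM2r; [exact: ltW | move: xinu etanu nu0; clear; lra].
  have h5 := ler_wpM2l (ltW sg0) (le_trans h4 h1).
  by move: h2 h3 h5 nk; clear; lra.
have YsX y : y \in Ys -> y \notin X by move=> /(subsetP sYs)/MX.
have bl y : y \notin X -> eps1 * n <= rho ^+ D * #|VR :&: \bigcap_(x in nb L y) Uc (s x)|%:R.
  move=> _; apply: (@le_trans _ _ (rho ^+ D * (c7 * n))); last by rewrite ler_pM2l // base_large.
  by rewrite mulrA ler_wpM2r // ltW.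
have eta80 : 0 <= eta / 8 by move: eta0; clear; lra.
have eta81 : eta / 8 <= 1 by move: eta1; clear; lra.
have a0 : 0 < nu / 512 by move: nu0; clear; lra.
have ap : nu / 512 <= eta / 8 by move: etanu nu0; clear; lra.
have g1 : eta / 2 <= 1 by move: eta1; clear; lra.
have Vc0 i : (0 < #|Vc i|)%N by rewrite -(ltr0n R).
(* Here [eps2] is [rho], the threshold for good clusters is [eta / 2], the hitting probability
   [eta / 8] and the share of choices [nu / 512]. With [B = 8 ^+ q] the dead sets have density at
   most [1 / q]. *)
have [f [okf hitf deadf]] := @embedding_exists R V G L m Vc Uc s X Main Ys VX VR D kst
  rho eps eps1 rho gam (eta / 2) (eta / 8) (nu / 512) (8 ^+ q) sys symL degL bip mainP sYs YsX
  disjYs disjVR rho0 rho1 (ltW eps0) (ltW rho0) eta80 eta81 a0 ap g1 B1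
  bl e1a av1 av2 epsB Vc0 good_many V0.
have [finj fplace fcand] := okf.
have nu64 : 0 <= nu / 64 by move: nu0; clear; lra.
have Sp_balance P : #|P :&: VX|%:R <= th0 * #|P|%:R + err * n ->
    #|~: (f @: X) :\: P|%:R <= (n - #|P|%:R) * th + nu / 32 * n.
  move=> hP; have fVX x : x \in X -> x \notin Sp -> f x \in VX by move=> xX; have [_ _] := fplace x xX.
  apply: le_trans (leftover_balanced V0 finj fVX hP cSp nu64) _.
  rewrite -/n -/th lerD2l; apply: ler_wpM2r; first exact: ltW.
  by move: err4 nu0; clear; lra.
apply: (copy_of_hall symG symL bip finj).
have small1 : rho + rho <= nu ^+ 2 / 16 by move: rhonu; clear; lra.
have small2 : 2 * (rho + rho) <= c * eta by move: rhoc; clear; lra.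
have xinu8 : xi <= nu / 8 by move: xinu nu0; clear; lra.
have q10 : 0 <= q%:R^-1 :> R by rewrite invr_ge0 ler0n.
have nu32 : 0 <= nu / 32 by move: nu0; clear; lra.
have e12 : q%:R^-1 + e4 <= rho ^+ D * c7 by move: q1 e4c; clear; lra.
have esum : q%:R^-1 + e4 + nu / 1024 + nu / 32 + rho <= nu / 8.
  by move: q2 e4nu rhonu nu2 nu0; clear; lra.
have Ybig : #|V|%:R <= 2 * #|~: X|%:R :> R.
  have h : 1 <= 2 * th by move: xth xn1; clear; lra.
  by rewrite thE -/n; have := ler_wpM2r (ltW n0) h; clear; lra.
apply: (hall_condition (s := s) symG bip finj sys cov mindeg expG V0 nu0 nutau taueta eta1 rho0 rho1 gam0
  small1 small2 xinu8 rho0 q10 (ltW e40) sl0 nu32 e12 esum Ybig MX).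
- move=> w; apply: le_trans (nh _ (hitf w)) _; apply: card_natr_le; apply/subsetP => y.
  rewrite inE => /andP[yYs /subsetP h]; rewrite inE /fits YsX //=; apply/forall_inP => x xy.
  by have := h x xy; rewrite inE.
- move=> y yX; apply: (@le_trans _ _ (rho ^+ #|nb L y :&: X| * #|VR :&: \bigcap_(x in nb L y) Uc (s x)|%:R)).
    rewrite -mulrA; apply: ler_pM (base_large y); [exact: ltW | by rewrite mulr_ge0 // ltW |].
    by rewrite ler_wiXn2l ?(ltW rho0) // (leq_trans (subset_leq_card (subsetIl _ _))).
  apply: le_trans (fcand y yX) _; apply: card_natr_le; apply/subsetP => w wc.
  rewrite inE (cand_fits symG bip yX wc) andbT inE; apply/imsetP => -[x xX e].
  have [_ + _] := fplace x xX; rewrite -e; move: wc; rewrite inE => /andP[+ _].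
  by rewrite inE => /andP[->].
- move=> T; have := dead_bound (max_card _) V0 (deadf T); rewrite -(ler_nat R) natrM => h.
  by rewrite [leRHS]mulrC ler_pdivlMr ?ltr0n // [leLHS]mulrC.
- exact: nonmain.
- exact: loadY.
- move=> I; apply: Sp_balance; have := HX (inl (inr I)); rewrite ler_norml /= -/n => /andP[_ h].
  by move: h; clear; lra.
- move=> i; apply: Sp_balance; have := HX (inr (i, i)); rewrite ler_norml /= setIid -/n => /andP[_ h].
  by move: h; clear; lra.
Qed.

(** * Order of choice of the constants *)

Lemma archi_mul (R : archiRealFieldType) (x : R) : 0 < x -> exists q : nat, 1 < q%:R * x.
Proof.
move=> x0; exists (Num.bound x^-1); have h : 0 <= x^-1 by rewrite invr_ge0 ltW.
by rewrite -[X in X < _](mulVf (lt0r_neq0 x0)) ltr_pM2r // archi_boundP.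
Qed.

(** The hosting density [c] depends only on [D], [nu] and [eta], so [rho] can be small compared with
    it. Then [q] bounds the dead sets, [eps] beats [8 ^+ q], and [k], [M] bound the clusters; only
    afterwards come [e4], [b], [err], [beta] and the threshold for [n]. *)
Lemma bandwidth_constants (R : archiRealFieldType) (D : nat) (nu tau eta : R) :
  0 < nu -> nu <= tau -> tau <= eta / 2 -> eta < 1 ->
  exists (beta : R) (n0 : nat), 0 < beta /\
    forall (V : finType) (G L : rel V) (X : {set V}) (lab : V -> nat),
    (n0 <= #|V|)%N -> symmetric G -> symmetric L ->
    (forall x y, L x y -> (x \in X) != (y \in X)) -> (forall v, (#|nb L v| <= D)%N) ->
    injective lab -> (forall v, (lab v < #|V|)%N) ->
    (forall x y, L x y -> (lab x)%:R <= (lab y)%:R + beta * #|V|%:R) ->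
    (forall v, eta * #|V|%:R <= #|nb G v|%:R) -> rexpander nu tau G ->
    (2 * #|X| <= #|V|)%N ->
    exists F : V -> V, injective F /\ forall u v, L u v -> G (F u) (F v).
Proof.
move=> nu0 nutau taueta eta1.
have eta0 : 0 < eta by lra.
have nu64 : 0 < nu / 64 by lra.
pose s2 : R := ((D + 1) ^ 2)%:R.
have s20 : 0 < s2 by rewrite ltr0n expn_gt0 addn1.
pose sigma := nu / 128 / s2; have sg0 : 0 < sigma by rewrite !divr_gt0.
have sgz z : (z <= (D + 1) ^ 2)%N -> sigma * z%:R <= nu / 128.
  move=> le; rewrite /sigma -mulrA -[leRHS]mulr1; apply: ler_wpM2l; first by lra.
  by rewrite mulrC ler_pdivrMr // mul1r ler_nat.
have eD0 : 0 < (eta / 8) ^+ D by rewrite exprn_gt0 // divr_gt0.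
have eD1 : (eta / 8) ^+ D <= 1 by apply: exprn_ile1; lra.
have lam01 : 0 <= 1 - (eta / 8) ^+ D / 2 < 1 by lra.
pose kap := sigma * (eta / 8); have kap0 : 0 < kap by rewrite mulr_gt0 // divr_gt0.
have [c [nh [c0 hc]]] := exists_hit_constant lam01 kap0.
have nu20 : 0 < nu ^+ 2 by rewrite exprn_gt0.
pose rho := Num.min (nu ^+ 2 / 32) (c * eta / 4).
have rho0 : 0 < rho by rewrite lt_min !divr_gt0 // mulr_gt0.
have rhonu : rho <= nu ^+ 2 / 32 by rewrite ge_min lexx.
have rhoc : rho <= c * eta / 4 by rewrite ge_min lexx orbT.
pose c7 := eta * nu ^+ 2 / 128; have c70 : 0 < c7 by rewrite divr_gt0 // mulr_gt0.
have rD0 : 0 < rho ^+ D by rewrite exprn_gt0.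
pose c6 := rho ^+ D * c7; have c60 : 0 < c6 by rewrite mulr_gt0.
pose qq := Num.min (c6 / 2) (nu / 64).
have qq0 : 0 < qq by rewrite lt_min !divr_gt0.
have [q hq] := archi_mul qq0.
have q0 : (0 < q)%N by case: q hq => //; rewrite mul0r ltr10.
have qle : q%:R^-1 <= qq by rewrite -[leLHS]mul1r ler_pdivrMr ?ltr0n // mulrC ltW.
have [q1 q2] : q%:R^-1 <= c6 / 2 /\ q%:R^-1 <= nu / 64.
  by move: qle; rewrite le_min => /andP[].
pose eps1 := Num.min (rho ^+ D * rho) (rho ^+ D * c7).
have e10 : 0 < eps1 by rewrite lt_min; apply/andP; split; apply: mulr_gt0.
have e1a : eps1 <= rho ^+ D * rho by rewrite ge_min lexx.
have e1b : eps1 <= rho ^+ D * c7 by rewrite ge_min lexx orbT.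
pose BD : R := (8 ^+ q) ^+ D; have BD0 : 0 < BD by rewrite !exprn_gt0.
have D1 : 0 < D%:R + 1 :> R by rewrite natr1 ltr0n.
pose eps := Num.min 1 (nu / 512 / (D%:R + 1) / BD).
have eps0 : 0 < eps by rewrite lt_min ltr01 !divr_gt0.
have eps01 : 0 < eps <= 1 by rewrite eps0 ge_min lexx.
have epsB : D%:R * eps * BD <= nu / 512.
  apply: (@le_trans _ _ ((D%:R + 1) * (nu / 512 / (D%:R + 1) / BD) * BD)).
    apply: ler_wpM2r; first exact: ltW.
    by apply: ler_pM; rewrite ?ler0n ?lerDl ?ler01 ?(ltW eps0) ?ge_min ?lexx ?orbT.
  by rewrite -mulrA divfK ?gt_eqF // mulrC divfK ?gt_eqF.
have [k hk] := archi_mul e10.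
pose xi := nu / 1024; have xi0 : 0 < xi by rewrite divr_gt0.
pose gam := eps ^+ k * xi; have gam0 : 0 < gam by rewrite mulr_gt0 // exprn_gt0.
have [M hM] := archi_mul gam0.
pose e4 := Num.min (Num.min 1 (c6 / 2)) (Num.min (nu / 2048 * gam) (nu / 1024)).
have g0 (x : R) z : 0 < x -> 0 < x / z.+1%:R * gam by move=> x0; rewrite mulr_gt0 // divr_gt0.
have e40 : 0 < e4 by rewrite !lt_min ltr01 g0 // !divr_gt0.
have e4l : e4 <= Num.min 1 (c6 / 2) by rewrite ge_min lexx.
have e4r : e4 <= Num.min (nu / 2048 * gam) (nu / 1024) by rewrite ge_min lexx orbT.
move: e4l e4r; rewrite !le_min => /andP[e41 e4c] /andP[e4g e4nu].
have M30 : 0 < (2 * (M + 3))%:R :> R by rewrite ltr0n muln_gt0 addn3.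
have [b0 hb0] := archi_mul (divr_gt0 e40 M30).
pose b := (M + 2 + b0)%N.
have bM : (M + 2 <= b)%N by rewrite leq_addr.
have b2 : 2 * (M + 3)%:R <= e4 * b%:R.
  move: hb0; rewrite mulrA ltr_pdivlMr // mul1r natrM => /ltW/le_trans; apply.
  by rewrite mulrC ler_wpM2l ?(ltW e40) // ler_nat leq_addl.
pose err := Num.min (Num.min (eta / 16 * gam) c7) (Num.min (nu / 1024 * gam) (nu / 1024)).
have err0 : 0 < err by rewrite !lt_min c70 !g0 // divr_gt0.
have erl : err <= Num.min (eta / 16 * gam) c7 by rewrite ge_min lexx.
have err' : err <= Num.min (nu / 1024 * gam) (nu / 1024) by rewrite ge_min lexx orbT.
move: erl err'; rewrite !le_min => /andP[er1 er2] /andP[er3 er4].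
have bR : 0 < b%:R :> R by rewrite ltr0n /b addnAC addn2.
(* With intervals of length at most [4 * beta * n], a block of [b] intervals stays below the limit
   of order [e4 ^+ 2 * n] needed to balance the blocks. *)
pose beta := e4 ^+ 2 / (16 * b%:R).
have beta0 : 0 < beta by rewrite divr_gt0 ?exprn_gt0 // mulr_gt0.
pose J : R := (M + 2 ^ M + M * M)%:R.
(* The summands guarantee, in order, the hosting bound, room for rounding the special counts,
   intervals of length comparable to [beta * n], the balance of the reservoirs, and [n >= 1]. *)
pose N := `|nh| + (M%:R + 1) / kap + 1 / (2 * beta) + 2 * J / err ^+ 2 + 1.
have N1 : 0 <= (M%:R + 1) / kap by rewrite ltW // divr_gt0 // natr1 ltr0n.
have N2 : 0 <= 1 / (2 * beta) by rewrite ltW // divr_gt0 // mulr_gt0.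
have N3 : 0 <= 2 * J / err ^+ 2 by rewrite mulr_ge0 ?mulr_ge0 ?ler0n // invr_ge0 exprn_ge0 // ltW.
have N0 : 0 <= N by have := normr_ge0 nh; move: N1 N2 N3; rewrite /N; clear; lra.
exists beta, (Num.bound N); split=> // V G L X lab nbig symG symL bip degL labi labl lablip mindeg expG Xn.
have Nn : N <= #|V|%:R.
  by apply: le_trans (ltW (archi_boundP N0)) _; rewrite ler_nat.
set n : R := #|V|%:R in Nn lablip mindeg.
have h0 : 0 <= `|nh| by [].
have n1 : 1 <= n by move: Nn h0 N1 N2 N3; rewrite /N; clear; lra.
have nnh : nh <= n by apply: le_trans (ler_norm nh) _; move: Nn h0 N1 N2 N3; rewrite /N; clear; lra.
have nM : M%:R + 1 <= kap * n.
  by rewrite mulrC -ler_pdivrMr //; move: Nn h0 N1 N2 N3; rewrite /N; clear; lra.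
have nbeta : 1 <= 2 * beta * n.
  have bb : 0 < 2 * beta by apply: mulr_gt0.
  by rewrite mulrC -(ler_pdivrMr _ _ bb); move: Nn h0 N1 N2 N3; rewrite /N; clear; lra.
have nJ : 2 * J <= err ^+ 2 * n.
  by rewrite [leRHS]mulrC -ler_pdivrMr ?exprn_gt0 //; move: Nn h0 N1 N2 N3; rewrite /N; clear; lra.
have V0 : (0 < #|V|)%N by rewrite -(ltr0n R); apply: lt_le_trans n1.
have n0 : 0 < n by rewrite ltr0n.
have bn0 : 0 < 2 * beta * n by apply: mulr_gt0 => //; apply: mulr_gt0.
(* Twice [beta * n], because two neighbours of one vertex may differ by that much in label. *)
have [ell0 /andP[el1 el2]] := exists_floor (ltW bn0).
have [kst0 /andP[ks1 ks2]] := exists_floor (ltW (mulr_gt0 kap0 n0)).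
have hell x y : (lab x)%:R <= (lab y)%:R + 2 * beta * n -> (lab x <= lab y + ell0.+1)%N.
  by rewrite -(ler_nat R) natrD -natr1; move: el2; clear; lra.
apply: (@copy_exists R V G L X lab D nu tau eta c rho eps eps1 e4 err sigma xi gam k M q b
  ell0.+1 kst0.+1) => //.
- move=> y x x' h1 h2; apply: hell; have := lablip x y; rewrite symL => /(_ h1).
  by have := lablip _ _ h2; clear; lra.
- move=> x y /lablip h; apply: hell; have := mulr_gt0 beta0 n0; move: h; clear; lra.
- by rewrite -natrM ler_nat.
- by move: rhoc; clear; lra.
- by apply: sgz; rewrite (leq_trans (leq_addr 1 D)) // -{1}[(D + 1)%N]expn1 leq_pexp2l // addn1.
- by apply: sgz; rewrite sqrnD mulnn exp1n leq_addr.
- exact: ltW.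
- by rewrite e40.
- by move: e4g; clear; lra.
- exact: ltW.
- rewrite natrM -natr1; have be : beta * (16 * b%:R) = e4 ^+ 2 by rewrite /beta divfK // gt_eqF // mulr_gt0.
  have h1 : ell0%:R + 1 <= 4 * beta * n by move: el1 nbeta; clear; lra.
  have h2 := ler_wpM2l (ltW bR) h1; have h3 := mulr_gt0 bR (mulr_gt0 beta0 n0).
  by rewrite -be; move: h2 h3; clear; lra.
- rewrite -natr1 -/n; have -> : sigma * (eta / 4) * n = 2 * (kap * n) by rewrite /kap; field.
  by move: ks1 nM; clear; lra.
- move=> h; apply: hc => //; rewrite -natr1; exact: ltW.
Qed.

(** * The theorem over the Stdlib reals *)

Lemma expander_of_robust (n : nat) (nu tau : Rdefinitions.R) (E : rel 'I_n) :
  robust_expander nu tau E -> rexpander nu tau E.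
Proof.
move=> expE S; rewrite card_ord => lo hi.
have -> : rnb nu E S = robust_nbhd nu E S.
  apply/setP => v; rewrite !inE card_ord; case: Rle_dec => h /=.
    by move: (h) => /RleP; rewrite RmultE !INRE.
  apply/negbTE/negP => le; case: h; apply/RleP; rewrite RmultE !INRE; apply: le.
have h1 : Rle (Rmult tau (INR n)) (INR #|S|) by apply/RleP; rewrite RmultE !INRE.
have h2 : Rle (INR #|S|) (Rmult (Rminus 1 tau) (INR n)).
  by apply/RleP; rewrite RmultE RminusE !INRE.
by have /RleP := expE S h1 h2; rewrite RplusE RmultE !INRE.
Qed.

Local Close Scope ring_scope.
Delimit Scope R_scope with R.

Theorem theorem1p8 :
  exists f : R -> R,
    (forall x, (0 < x < 1)%R -> (0 < f x)%R) /\
    (forall x y, (0 < x)%R -> (x <= y)%R -> (y < 1)%R -> (f x <= f y)%R) /\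
    forall (Delta : nat) (nu tau eta : R),
      (0 < nu)%R -> (nu <= tau)%R -> (tau <= f eta)%R ->
      (0 < eta)%R -> (eta < 1)%R ->
      exists (beta : R) (n0 : nat), (0 < beta)%R /\
        forall (n : nat) (H G : rel 'I_n),
          n0 <= n ->
          simple_graph H -> bipartite H -> max_degree_le H Delta ->
          bandwidth_le H (beta * INR n) ->
          simple_graph G -> min_degree_ge G (eta * INR n) ->
          robust_expander nu tau G ->
          contains_copy G H.
Proof.
Local Open Scope ring_scope.
(* With [tau <= eta / 2], a neighbourhood keeps at least [eta / 2 * n] vertices inside any set that
   misses at most [tau * n]. *)
exists (fun x : Rdefinitions.R => x / 2); split; [|split].
- by move=> x [/RltP x0 _]; apply/RltP; rewrite divr_gt0.
- by move=> x y _ /RleP xy _; apply/RleP; rewrite ler_pM2r ?invr_gt0.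
move=> D nu tau eta /RltP nu0 /RleP nutau /RleP taueta _ /RltP eta1.
have [beta [n0 [beta0 embed]]] := bandwidth_constants D nu0 nutau taueta eta1.
exists beta, n0; split; first exact/RltP.
move=> n H G n0n [symH _] [col colH] degH [lab [labi lablip]] [symG _] mindeg expG.
have lip x y : H x y -> (lab x)%:R <= (lab y)%:R + beta * #|'I_n|%:R.
  move/lablip/RleP; rewrite RabsE RminusE RmultE !INRE card_ord ler_norml => /andP[_].
  by rewrite lerBlDl.
have mind v : eta * #|'I_n|%:R <= #|nb G v|%:R.
  by have /RleP := mindeg v; rewrite RmultE !INRE card_ord; apply.
have key (X : {set 'I_n}) : (forall x y, H x y -> (x \in X) != (y \in X)) ->
    (2 * #|X| <= #|'I_n|)%N -> contains_copy G H.
  move=> bipX leX; rewrite -[n]card_ord in n0n.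
  apply: (embed 'I_n G H X (fun v => lab v)) => //.
  - by move=> x y /val_inj/labi.
  - by move=> v; rewrite card_ord ltn_ord.
  - exact: expander_of_robust.
(* The smaller colour class is placed first, so that the class left to Hall's theorem has proportion
   at least [1 / 2] and the expansion margin is at most halved. *)
pose X := [set v | col v].
have [leX|gtX] := leqP (2 * #|X|) #|'I_n|.
  by apply: key leX => x y /colH; rewrite !inE.
apply: (key (~: X)) => [x y /colH|]; first by rewrite !inE; case: (col x); case: (col y).
have e := cardsC X; move: gtX; rewrite -e.
by move: #|X| #|~: X| => i j; lia.
Qed.
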